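(* Let $a>0$ be a real number with $a\neq 1$, let $G_a=B_a\rtimes_{\alpha_a}\mathbb{Z}$ with generators $u=(0,1)$ and $v=(1,0)$, let $A=\mathcal{U}_a=C^*(G_a)$ and let $\mathcal{A}=\mathbb{C}[G_a]\subset A$ be the group algebra. (i) There exist spectral triples $(\pi(\mathcal{A}),\mathcal{H}_\pi,\mathcal{D})$ which are compact, i.e. such that $[\mathcal{D},\pi(x)]$ is compact for all $x\in\mathcal{A}$. (ii) There exist spectral triples $(\pi(\mathcal{A}),\mathcal{H}_\pi,\mathcal{D})$ such that $[\mathcal{D},\pi(x)]=0$ for all $x\in\mathcal{U}_a$, and with arbitrary summability: for every real $p\geq 1$ there is such a triple which is $p$-summable. (iii) When $a$ is algebraic, there exist spectral triples $(\pi(\mathcal{A}),\mathcal{H}_\pi,\mathcal{D})$ such that $[\mathcal{D},\pi(v)]=0$ and $[\mathcal{D},\pi(u)]\neq 0$, and with arbitrary summability $p\geq 2$: for every real $p\geq 2$ there is such a triple which is $p$-summable.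
   Context: For real $a>0$, $B_a:=\{\sum_i m_i a^{n_i} : \text{finite sums},\ m_i,n_i\in\mathbb{Z}\}\subset\mathbb{R}$ is regarded as a discrete additive group, $\mathbb{Z}$ acts on it by $\alpha_a(n)b:=a^n b$, and $G_a:=B_a\rtimes_{\alpha_a}\mathbb{Z}$ is the discrete group with law $(b,l)(b',l')=(b+a^l b',\,l+l')$; it is generated by $u=(0,1)$ and $v=(1,0)$. $\mathcal{U}_a:=C^*(G_a)$ is its group $C^*$-algebra. A spectral triple $(\pi(\mathcal{A}),\mathcal{H}_\pi,\mathcal{D})$ here means: a faithful representation $\pi$ of the unital $C^*$-algebra $A$ on a Hilbert space $\mathcal{H}_\pi$, and an unbounded self-adjoint operator $\mathcal{D}$ on $\mathcal{H}_\pi$ such that $[\mathcal{D},\pi(x)]$ is bounded for all $x$ in the norm-dense $*$-subalgebra $\mathcal{A}$ of $A$ (i.e. $\pi(x)$ preserves the domain of $\mathcal{D}$ and the commutator extends to a bounded operator), and $(1+\mathcal{D}^2)^{-1}$ is compact. It is $p$-summable ($1\le p<\infty$) if $\mathrm{Tr}\big((1+\mathcal{D}^2)^{-p/2}\big)<\infty$. *)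

(* Defs.v *)
From HB Require Import structures.
From mathcomp Require Import all_boot all_order all_algebra complex.
From mathcomp Require Import ring.
From mathcomp Require Import all_classical all_reals all_analysis.

Set Implicit Arguments.
Unset Strict Implicit.
Unset Printing Implicit Defensive.

Import Order.TTheory GRing.Theory Num.Theory.
Import numFieldNormedType.Exports.

Local Open Scope classical_set_scope.
Local Open Scope ring_scope.

(* The inner product is linear in its first argument. *)
Record hilbert (R : realType) := Hilbert {
  hspace :> completeNormedModType R[i];
  hdot : {dot hspace for Num.conj};
  hdotE : forall x, hdot x x = `|x| ^+ 2 }.

Notation "'[ x , y ]" := (hdot _ x y) : ring_scope.

Section BoundedOperators.
Variables (R : realType) (H : hilbert R).

Record bop := Bop {
  bop_fun :> H -> H;
  bop_linear : linear bop_fun;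
  bop_continuous : continuous bop_fun }.

Implicit Types S T : bop.

Lemma bop_ext S T : (forall x, S x = T x) -> S = T.
Proof.
case: S T => [f fl fc] [g gl gc] /= /funext fg; rewrite -{}fg in gl gc *.
by rewrite (Prop_irrelevance fl gl) (Prop_irrelevance fc gc).
Qed.

HB.instance Definition _ T :=
  GRing.isLinear.Build R[i] H H _ (bop_fun T) (@bop_linear T).

HB.instance Definition _ := gen_eqMixin bop.
HB.instance Definition _ := gen_choiceMixin bop.

Fact bop_zero_linear : linear (fun _ : H => 0 : H).
Proof. by move=> c x y; rewrite scaler0 addr0. Qed.
Definition bop_zero : bop := Bop bop_zero_linear (@cst_continuous H H 0).

Fact bop_opp_linear T : linear (fun x => - T x).
Proof. by move=> c x y; rewrite linearP opprD scalerN. Qed.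
Fact bop_opp_continuous T : continuous (fun x => - T x).
Proof. by move=> x; apply: continuousN; exact: bop_continuous. Qed.
Definition bop_opp T := Bop (bop_opp_linear T) (bop_opp_continuous (T := T)).

Fact bop_add_linear S T : linear (fun x => S x + T x).
Proof. by move=> c x y; rewrite !linearP scalerDr addrACA. Qed.
Fact bop_add_continuous S T : continuous (fun x => S x + T x).
Proof. by move=> x; apply: continuousD; exact: bop_continuous. Qed.
Definition bop_add S T :=
  Bop (bop_add_linear S T) (bop_add_continuous (S := S) (T := T)).

Fact bop_scale_linear (k : R[i]) T : linear (fun x => k *: T x).
Proof. by move=> c x y; rewrite linearP scalerDr !scalerA mulrC. Qed.
Fact bop_scale_continuous (k : R[i]) T : continuous (fun x => k *: T x).
Proof. by move=> x; apply: continuousZl_tmp; exact: bop_continuous. Qed.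
Definition bop_scale k T :=
  Bop (bop_scale_linear k T) (bop_scale_continuous (k := k) (T := T)).

Fact bop_one_linear : linear (fun x : H => x).
Proof. by []. Qed.
Fact bop_one_continuous : continuous (fun x : H => x).
Proof. by move=> x. Qed.
Definition bop_one := Bop bop_one_linear bop_one_continuous.

Fact bop_mul_linear S T : linear (fun x => S (T x)).
Proof. by move=> c x y; rewrite !linearP. Qed.
Fact bop_mul_continuous S T : continuous (fun x => S (T x)).
Proof. by move=> x; apply: continuous_comp; exact: bop_continuous. Qed.
Definition bop_mul S T :=
  Bop (bop_mul_linear S T) (bop_mul_continuous (S := S) (T := T)).

Fact bop_addA : associative bop_add.
Proof. by move=> S T U; apply: bop_ext => x /=; rewrite addrA. Qed.
Fact bop_addC : commutative bop_add.
Proof. by move=> S T; apply: bop_ext => x /=; rewrite addrC. Qed.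
Fact bop_add0 : left_id bop_zero bop_add.
Proof. by move=> S; apply: bop_ext => x /=; rewrite add0r. Qed.
Fact bop_addN : left_inverse bop_zero bop_opp bop_add.
Proof. by move=> S; apply: bop_ext => x /=; rewrite addNr. Qed.
HB.instance Definition _ :=
  GRing.isZmodule.Build bop bop_addA bop_addC bop_add0 bop_addN.

Fact bop_mulA : associative bop_mul.
Proof. by move=> S T U; apply: bop_ext. Qed.
Fact bop_mul1 : left_id bop_one bop_mul.
Proof. by move=> S; apply: bop_ext. Qed.
Fact bop_mulr1 : right_id bop_one bop_mul.
Proof. by move=> S; apply: bop_ext. Qed.
Fact bop_mulDl : left_distributive bop_mul bop_add.
Proof. by move=> S T U; apply: bop_ext. Qed.
Fact bop_mulDr : right_distributive bop_mul bop_add.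
Proof. by move=> S T U; apply: bop_ext => x /=; rewrite linearD. Qed.
HB.instance Definition _ := GRing.Zmodule_isPzRing.Build bop
  bop_mulA bop_mul1 bop_mulr1 bop_mulDl bop_mulDr.

Fact bop_scaleA a b T : bop_scale a (bop_scale b T) = bop_scale (a * b) T.
Proof. by apply: bop_ext => x /=; rewrite scalerA. Qed.
Fact bop_scale1 : left_id 1 bop_scale.
Proof. by move=> S; apply: bop_ext => x /=; rewrite scale1r. Qed.
Fact bop_scaleDr : right_distributive bop_scale +%R.
Proof. by move=> a S T; apply: bop_ext => x /=; rewrite scalerDr. Qed.
Fact bop_scaleDl T : {morph bop_scale^~ T : a b / a + b}.
Proof. by move=> a b; apply: bop_ext => x /=; rewrite scalerDl. Qed.
HB.instance Definition _ := GRing.Zmodule_isLmodule.Build R[i] bop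
  bop_scaleA bop_scale1 bop_scaleDr bop_scaleDl.

Lemma bop_bounded T : exists2 M : R[i], 0 < M & forall x, `|T x| <= M * `|x|.
Proof.
have /linear_boundedP/pinfty_ex_gt0 [M M0 TM] :=
  continuous_linear_bounded 0 (@bop_continuous T 0).
by exists M.
Qed.

End BoundedOperators.

Record unitary_rep (R : realType) (G : groupType) := UnitaryRep {
  urep_space : hilbert R;
  urep :> G -> bop urep_space;
  urep1 : urep 1%g = 1;
  urepM : forall g h, urep (g * h)%g = urep g * urep h;
  urep_dot : forall g x y, '[urep g x, urep g y] = '[x, y] }.

Section HilbertFacts.
Variables (R : realType) (H : hilbert R).
Implicit Types x y : H.

Lemma hdotC x y : '[y, x] = ('[x, y])^*.
Proof. by rewrite hermC expr0 mul1r. Qed.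

Lemma hdotBl x y z : '[x - y, z] = '[x, z] - '[y, z] :> R[i].
Proof. by rewrite linearBl. Qed.

Lemma hdotBr x y z : '[x, y - z] = '[x, y] - '[x, z] :> R[i].
Proof. by rewrite linearBr. Qed.

Lemma hdotDr x y z : '[x, y + z] = '[x, y] + '[x, z] :> R[i].
Proof. by rewrite linearDr. Qed.

Lemma hdotZl (k : R[i]) x y : '[k *: x, y] = k * '[x, y] :> R[i].
Proof. by rewrite linearZl_LR. Qed.

Lemma hdotZr (k : R[i]) x y : '[x, k *: y] = k^* * '[x, y] :> R[i].
Proof. by rewrite linearZr_LR. Qed.

Lemma hdot_le x y : `|'[x, y]| <= `|x| * `|y|.
Proof.
have [->|y0] := eqVneq y 0; first by rewrite linear0r !normr0 mulr0.
have ny0 : 0 < `|y| by rewrite normr_gt0.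
rewrite -(@ler_pXn2r _ 2%N) ?nnegrE ?mulr_ge0 //.
pose k := '[x, y] / `|y| ^+ 2.
have n2 : `|y| ^+ 2 != 0 by rewrite expf_neq0 ?normr_eq0.
have : 0 <= '[x - k *: y, x - k *: y] by rewrite hdotE exprn_ge0.
rewrite hdotBl !hdotBr hdotZl !hdotZr hdotZl (hdotE x) (hdotE y).
rewrite (hdotC x y) [k^*]rmorphM /= fmorphV /=.
have nr : (`|y| ^+ 2)^* = `|y| ^+ 2 by rewrite conj_Creal ?ger0_real ?exprn_ge0.
rewrite nr (_ : _ - _ = `|x| ^+ 2 - `|'[x, y]| ^+ 2 / `|y| ^+ 2).
  by rewrite subr_ge0 ler_pdivrMr ?exprn_gt0// exprMn.
by rewrite normCK /k; field; rewrite expf_neq0 ?normr_eq0 in n2 *.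
Qed.

Lemma hdot_inj x y : (forall z, '[z, x] = '[z, y]) -> x = y.
Proof.
move=> xy; apply/eqP; rewrite -subr_eq0 -(dnorm_eq0 (hdot H)).
by rewrite hdotBr xy subrr.
Qed.

Lemma adjoint_le (f g : H -> H) (M : R[i]) : 0 <= M ->
  (forall x y, '[f x, y] = '[x, g y]) ->
  (forall x, `|f x| <= M * `|x|) -> forall y, `|g y| <= M * `|y|.
Proof.
move=> M0 fg fM y; have [->|gy0] := eqVneq (g y) 0.
  by rewrite normr0 mulr_ge0.
rewrite -(ler_pM2r (_ : 0 < `|g y|)) ?normr_gt0//.
rewrite -expr2 -hdotE -fg.
rewrite -[leLHS]ger0_norm ?fg ?hdotE ?exprn_ge0// -hdotE -fg.
rewrite (le_trans (hdot_le _ _))// mulrAC; apply: ler_wpM2r => //.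
Qed.
End HilbertFacts.

Section GroupCstarAlgebra.
Variables (R : realType) (G : groupType).
Local Notation rep := (unitary_rep R G).
Implicit Types (rho : rep) (s : seq (R[i] * G)).

Definition rep_sum rho s : bop (urep_space rho) := \sum_(c <- s) c.1 *: rho c.2.

(* The full group C*-algebra: the closure of the linear span of G, for the norm
   sup_rho ||.||, in the product over all unitary representations rho of the
   algebras of bounded operators. Its operations are pointwise. The type of
   all representations lives in too large a universe for [group_cstar] to be
   an instance of the algebraic structures of the library.
   [e : R[i]] with [0 < e] is a positive real number. *)
Record group_cstar := GroupCstar {
  gc_val :> forall rho, bop (urep_space rho);
  gc_approx : forall e : R[i], 0 < e -> exists s, forall rho v,
    `|gc_val rho v - rep_sum rho s v| <= e * `|v| }.
Implicit Types x y : group_cstar.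

Lemma gc_ext x y : (forall rho, x rho = y rho) -> x = y.
Proof.
case: x y => [f fa] [g ga] /= fg0; have fg := functional_extensionality_dep fg0.
by rewrite -{}fg in ga *; rewrite (Prop_irrelevance fa ga).
Qed.

Fact gc_sum_approx s (e : R[i]) : 0 < e -> exists s', forall rho v,
  `|rep_sum rho s v - rep_sum rho s' v| <= e * `|v|.
Proof. by move=> e0; exists s => rho v; rewrite subrr normr0 mulr_ge0 // ltW. Qed.
Definition gc_sum s := GroupCstar (@gc_sum_approx s).

Definition gc_elt (g : G) := gc_sum [:: (1, g)].

Definition gc_one := gc_elt 1%g.

Lemma rep_sum_cat rho s t :
  rep_sum rho (s ++ t) = rep_sum rho s + rep_sum rho t.
Proof. by rewrite /rep_sum big_cat. Qed.

Lemma rep_sum_scale rho (k : R[i]) s :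
  rep_sum rho [seq (k * c.1, c.2) | c <- s] = k *: rep_sum rho s.
Proof.
by rewrite /rep_sum big_map scaler_sumr; apply: eq_bigr => c _; rewrite scalerA.
Qed.

Lemma bop_scaleAl H (k : R[i]) (S T : bop H) : (k *: S) * T = k *: (S * T).
Proof. exact: bop_ext. Qed.

Lemma bop_scaleAr H (k : R[i]) (S T : bop H) : S * (k *: T) = k *: (S * T).
Proof. by apply: bop_ext => x /=; rewrite linearZ. Qed.

Lemma rep_sum_mul rho s t :
  rep_sum rho [seq (c.1 * d.1, (c.2 * d.2)%g) | c <- s, d <- t] =
  rep_sum rho s * rep_sum rho t.
Proof.
rewrite /rep_sum big_allpairs_dep /= mulr_suml; apply: eq_bigr => c _.
rewrite mulr_sumr; apply: eq_bigr => d _.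
by rewrite urepM bop_scaleAl bop_scaleAr scalerA.
Qed.

Lemma bop_sumE (H : hilbert R) I (r : seq I) (F : I -> bop H) (v : H) :
  (\sum_(i <- r) F i) v = \sum_(i <- r) F i v.
Proof. by elim: r => [|i r IH]; rewrite ?big_nil// !big_cons -IH. Qed.

Lemma rep_sum_adjoint rho s v w :
  '[rep_sum rho s v, w] =
  '[v, rep_sum rho [seq ((c.1)^*, (c.2)^-1%g) | c <- s] w] :> R[i].
Proof.
rewrite /rep_sum big_map !bop_sumE linear_sumlz /= linear_sumr /=.
apply: eq_bigr => c _; rewrite hdotZl hdotZr /= conjCK; congr (_ * _).
by rewrite -(urep_dot (u := rho) (c.2)^-1%g) -[rho _ (rho _ _)]/((rho _ * rho _) _) -urepM mulVg urep1.
Qed.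

Fact gc_add_approx x y (e : R[i]) : 0 < e -> exists s, forall rho v,
  `|(x rho + y rho) v - rep_sum rho s v| <= e * `|v|.
Proof.
move=> e0; have e20 : 0 < e / 2 by rewrite divr_gt0.
have [s xs] := gc_approx x e20; have [t yt] := gc_approx y e20.
exists (s ++ t) => rho v; rewrite rep_sum_cat /= opprD addrACA.
rewrite (le_trans (ler_normD _ _))// [e]splitr mulrDl.
by rewrite lerD.
Qed.
Definition gc_add x y := GroupCstar (@gc_add_approx x y).

Fact gc_scale_approx (k : R[i]) x (e : R[i]) : 0 < e -> exists s, forall rho v,
  `|(k *: x rho) v - rep_sum rho s v| <= e * `|v|.
Proof.
move=> e0; have k0 : 0 < `|k| + 1 by rewrite ltr_wpDl.
have [s xs] := gc_approx x (divr_gt0 e0 k0).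
exists [seq (k * c.1, c.2) | c <- s] => rho v; rewrite rep_sum_scale /=.
rewrite -scalerBr normrZ (le_trans (ler_wpM2l _ (xs _ _)))//.
rewrite mulrA ler_wpM2r// mulrCA -[leRHS]mulr1 ler_wpM2l ?ltW//.
by rewrite ltr_pdivrMr// mul1r ltrDl.
Qed.
Definition gc_scale k x := GroupCstar (@gc_scale_approx k x).

Lemma rep_sum_bound s :
  exists2 M : R[i], 0 < M & forall rho v, `|rep_sum rho s v| <= M * `|v|.
Proof.
elim: s => [|c s [M M0 IH]].
  by exists 1 => // rho v; rewrite /rep_sum big_nil normr0 mulr_ge0.
exists (`|c.1| + M) => [|rho v]; first by rewrite ltr_wpDl.
rewrite /rep_sum big_cons /= (le_trans (ler_normD _ _))// mulrDl lerD//.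
rewrite normrZ ler_wpM2l// -(@ler_pXn2r _ 2%N) ?nnegrE//.
by rewrite -!hdotE urep_dot.
Qed.

Lemma gc_bound x :
  exists2 M : R[i], 0 < M & forall rho v, `|x rho v| <= M * `|v|.
Proof.
have [s xs] := gc_approx x ltr01; have [M M0 sM] := rep_sum_bound s.
exists (1 + M) => [|rho v]; first by rewrite addr_gt0.
rewrite -[x rho v](subrK (rep_sum rho s v)) (le_trans (ler_normD _ _))//.
by rewrite mulrDl lerD.
Qed.

Fact gc_mul_approx x y (e : R[i]) : 0 < e -> exists s, forall rho v,
  `|(x rho * y rho) v - rep_sum rho s v| <= e * `|v|.
Proof.
move=> e0; have e20 : 0 < e / 2 by rewrite divr_gt0.
have [M M0 yM] := gc_bound y.
have [s xs] := gc_approx x (divr_gt0 e20 M0).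
have [N N0 sN] := rep_sum_bound s.
have [t yt] := gc_approx y (divr_gt0 e20 N0).
exists [seq (c.1 * d.1, (c.2 * d.2)%g) | c <- s, d <- t] => rho v.
rewrite rep_sum_mul /= -[X in `|X|](subrKA (rep_sum rho s (y rho v))).
rewrite (le_trans (ler_normD _ _))// [e]splitr mulrDl lerD//.
  rewrite (le_trans (xs _ _))// (le_trans (ler_wpM2l (ltW (divr_gt0 e20 M0)) (yM _ _)))//.
  by rewrite mulrA divfK ?gt_eqF.
rewrite -(linearB (rep_sum rho s)) (le_trans (sN _ _))//.
rewrite (le_trans (ler_wpM2l (ltW N0) (yt _ _)))//.
by rewrite mulrA mulrCA divff ?gt_eqF// mulr1.
Qed.
Definition gc_mul x y := GroupCstar (@gc_mul_approx x y).


Definition star_seq s := [seq ((c.1)^*, (c.2)^-1%g) | c <- s].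

Lemma complex_gt0_real (e : R[i]) : 0 < e -> exists2 r : R, 0 < r & e = (r%:C)%C.
Proof.
move=> e0; exists (complex.Re e); last by rewrite RRe_real ?gtr0_real.
by rewrite -(ltcR 0) RRe_real ?gtr0_real.
Qed.

Lemma gc_adjoint_ex x rho (w : urep_space rho) :
  exists u, forall v, '[x rho v, w] = '[v, u].
Proof.
pose h (n : nat) : R[i] := ((n.+1%:R^-1 : R)%:C)%C.
have h0 n : 0 < h n by rewrite ltcR invr_gt0.
have hlt (e : R[i]) : 0 < e -> exists N, forall n, (N <= n)%N -> h n <= e.
  move=> /complex_gt0_real[r r0 ->].
  have [N _ Nr] := near_infty_natSinv_lt (PosNum r0).
  by exists N => n Nn; rewrite lecR; exact/ltW/Nr.
have [s xs] := choice (fun n => gc_approx x (h0 n)).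
pose u n := rep_sum rho (star_seq (s n)) w.
have uE n v : '[rep_sum rho (s n) v, w] = '[v, u n] :> R[i].
  exact: rep_sum_adjoint.
have uB n m : `|u n - u m| <= (h n + h m) * `|w|.
  apply: (@adjoint_le _ _ (rep_sum rho (s n) - rep_sum rho (s m))
    (rep_sum rho (star_seq (s n)) - rep_sum rho (star_seq (s m))) _ _ _ _ w).
  - by rewrite addr_ge0 ?ltW.
  - by move=> a b; rewrite /= hdotBl hdotBr !rep_sum_adjoint.
  - move=> a /=; rewrite -(subrKA (x rho a)) (le_trans (ler_normD _ _))//.
    by rewrite mulrDl lerD// distrC.
have w0 : 0 < `|w| + 1 by rewrite ltr_wpDl.
have : cauchy (u @ \oo).
  apply: cauchy_exP => e e0.
  have e40 : 0 < e / (`|w| + 1) / 2 by rewrite !divr_gt0.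
  have [N hN] := hlt _ e40; exists (u N); exists N => // n /= Nn.
  rewrite -ball_normE /= (le_lt_trans (uB _ _))//.
  rewrite (le_lt_trans (ler_wpM2r _ (lerD (hN N _) (hN n _))))//.
  by rewrite -splitr mulrAC ltr_pdivrMr// ltr_pM2l// ltrDl.
move=> /cauchy_cvg ul; exists (lim (u @ \oo)) => v.
set l := lim _; apply/eqP; rewrite -subr_eq0 -normr_le0 real_leNgt ?realE//.
apply/negP => d0; set d := `|_| in d0.
have C0 : 0 < `|v| * `|w| + `|v| + 1.
  by rewrite ltr_wpDl// addr_ge0// mulr_ge0.
pose eps := d / (`|v| * `|w| + `|v| + 1).
have e0 : 0 < eps by exact: divr_gt0.
have [N hN] := hlt _ e0.
have /cvgrPdist_le/(_ _ e0)[M _ lM] : u @ \oo --> l by exact: ul.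
have /lM{}lM : (M <= maxn M N)%N by exact: leq_maxl.
have /hN{}hN : (N <= maxn M N)%N by exact: leq_maxr.
suff : d < d by rewrite ltxx.
apply: (@le_lt_trans _ _ (eps * (`|v| * `|w| + `|v|))).
  rewrite {1}/d -(subrKA ('[rep_sum rho (s (maxn M N)) v, w])).
  rewrite (le_trans (ler_normD _ _))// mulrDr lerD//.
    rewrite -hdotBl (le_trans (hdot_le _ _))// mulrA ler_wpM2r//.
    apply: (le_trans (xs _ _ _)); apply: ler_wpM2r => //; exact: hN.
  rewrite uE -hdotBr (le_trans (hdot_le _ _))// mulrC ler_wpM2r//.
  by rewrite distrC.
by rewrite /eps mulrAC ltr_pdivrMr// ltr_pM2l// ltrDl.
all: by rewrite ?normr_ge0 ?lexx.
Qed.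

Lemma gc_star_ex x : exists y : forall rho, bop (urep_space rho),
  forall rho v w, '[x rho v, w] = '[v, y rho w].
Proof.
have [M M0 xM] := gc_bound x.
suff /all_sig [y yP] : forall rho, {y : bop (urep_space rho) |
    forall v w, '[x rho v, w] = '[v, y w]} by exists y.
move=> rho; apply: cid.
have [g gP] := choice (@gc_adjoint_ex x rho).
have gl : linear g.
  move=> k a b; apply: hdot_inj => z.
  by rewrite hdotDr hdotZr -!gP hdotDr hdotZr.
have gc : continuous g.
  pose gL := GRing.isLinear.Build R[i] _ _ _ g gl.
  pose G' : {linear _ -> _} := HB.pack g gL.
  apply: (@bounded_linear_continuous _ _ _ G'); apply/linear_boundedP.
  exists M; split; first exact: gtr0_real.
  move=> r Mr v.
  have gM : `|g v| <= M * `|v|.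
    by apply: (adjoint_le (ltW M0)) v => // a b; rewrite gP.
  by rewrite (le_trans gM)// ler_wpM2r// ltW.
by exists (Bop gl gc) => v w /=; rewrite gP.
Qed.

Fact gc_star_approx x (e : R[i]) : 0 < e -> exists s, forall rho v,
  `|projT1 (cid (gc_star_ex x)) rho v - rep_sum rho s v| <= e * `|v|.
Proof.
move=> e0; have [s xs] := gc_approx x e0.
exists (star_seq s) => rho; case: cid => y yP /= v.
apply: (@adjoint_le _ _ (x rho - rep_sum rho s)
  (y rho - rep_sum rho (star_seq s)) e _ _ _ v); first exact: ltW.
- by move=> a b; rewrite /= hdotBl hdotBr rep_sum_adjoint yP.
- exact: xs.
Qed.
Definition gc_star x := GroupCstar (@gc_star_approx x).

Lemma gc_starP x rho v w : '[x rho v, w] = '[v, gc_star x rho w].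
Proof. by rewrite /gc_star /=; case: cid. Qed.

End GroupCstarAlgebra.

(* Unital *-representations of the group C*-algebra. *)
Record cstar_rep (R : realType) (G : groupType) (H : hilbert R) := CstarRep {
  crep :> group_cstar R G -> bop H;
  crep1 : crep (gc_one R G) = 1;
  crepD : forall x y, crep (gc_add x y) = crep x + crep y;
  crepZ : forall k x, crep (gc_scale k x) = k *: crep x;
  crepM : forall x y, crep (gc_mul x y) = crep x * crep y;
  crep_star : forall x v w, '[crep x v, w] = '[v, crep (gc_star x) w] }.

Definition in_group_algebra (R : realType) (G : groupType)
    (x : group_cstar R G) : Prop := exists s, x = gc_sum s.

Section UnboundedOperators.
Variables (R : realType) (H : hilbert R).

(* Only the values of [uop_fun] on [uop_dom] are meaningful. *)
Record unbounded_op := UnboundedOp {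
  uop_dom : set H;
  uop_fun :> H -> H;
  uop_dom0 : uop_dom 0;
  uop_domP : forall (k : R[i]) v w,
    uop_dom v -> uop_dom w -> uop_dom (k *: v + w);
  uop_linear : forall (k : R[i]) v w, uop_dom v -> uop_dom w ->
    uop_fun (k *: v + w) = k *: uop_fun v + uop_fun w }.

Implicit Types (D : unbounded_op) (P T K : bop H).

(* The graph of the adjoint of [D]. *)
Definition adjoint_graph D (w z : H) :=
  forall v, uop_dom D v -> '[D v, w] = '[v, z].

Definition selfadjoint D := dense (uop_dom D) /\
  forall w z, adjoint_graph D w z <-> uop_dom D w /\ D w = z.

(* [P] preserves the domain of [D] and [T] extends [D P - P D]; for a densely
   defined [D] there is at most one such bounded [T]. *)
Definition is_commutator D P T := forall v, uop_dom D v ->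
  uop_dom D (P v) /\ D (P v) - P (D v) = T v.

Definition compact_op T := precompact (T @` [set v | `|v| <= 1]).

(* [K] is the inverse of [1 + D^2], whose domain is the set of [v] in the
   domain of [D] such that [D v] is in the domain of [D]. *)
Definition is_resolvent D K :=
  (forall w, [/\ uop_dom D (K w), uop_dom D (D (K w)) &
                 K w + D (D (K w)) = w]) /\
  (forall v, uop_dom D v -> uop_dom D (D v) -> K (v + D (D v)) = v).

Definition poly_op (q : {poly R}) K : bop H :=
  \sum_(i < size q) (q`_i)%:C%C *: K ^+ i.

(* Continuous functional calculus for a selfadjoint [K] with spectrum in
   [0, 1]: [T = f(K)] is the limit in operator norm of [q(K)] as the
   polynomial [q] tends to [f] uniformly on [0, 1]. *)
Definition is_funcalc (f : R -> R) K T :=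
  forall e : R, 0 < e -> exists2 d : R, 0 < d &
    forall q : {poly R}, (forall t, 0 <= t <= 1 -> `|q.[t] - f t| <= d) ->
    forall v, `|poly_op q K v - T v| <= e%:C%C * `|v|.

Definition orthonormal_basis (E : set H) :=
  (forall v w, E v -> E w -> '[v, w] = (v == w)%:R) /\
  (forall v, (forall w, E w -> '[v, w] = 0) -> v = 0).

(* Meant for positive [T], for which it does not depend on the basis [E]. *)
Definition op_trace (E : set H) T : \bar R :=
  \esum_(v in E) (complex.Re '[T v, v])%:E.

(* The operator [(1 + D^2)^(-p/2)] is obtained as [K^(p/2)] where
   [K := (1 + D^2)^-1], for which [0 <= K <= 1]. *)
Definition summable_op (p : R) D := exists K T E,
  [/\ is_resolvent D K, is_funcalc (fun t => t `^ (p / 2)) K T,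
      orthonormal_basis E & (op_trace E T < +oo)%E].

End UnboundedOperators.

(* For the dense *-subalgebra C[G]. *)
Definition spectral_triple (R : realType) (G : groupType) (H : hilbert R)
    (pi : cstar_rep G H) (D : unbounded_op H) :=
  [/\ injective pi,
      selfadjoint D,
      forall x, in_group_algebra x -> exists T, is_commutator D (pi x) T &
      exists2 K, is_resolvent D K & compact_op K].

Section GroupGa.
Variables (R : realType) (a : {posnum R}).
Local Notation a_ := (a%:num).

Definition Ba : {pred R} :=
  [pred b | `[< exists s : seq (int * int),
                  b = \sum_(p <- s) p.1%:~R * a_ ^ p.2 >]].

Lemma BaP b : reflect (exists s : seq (int * int),
  b = \sum_(p <- s) p.1%:~R * a_ ^ p.2) (b \in Ba).
Proof. exact: asboolP. Qed.

Fact Ba_zmod : zmod_closed Ba.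
Proof.
split=> [|_ _ /BaP[s ->] /BaP[t ->]]; apply/BaP.
  by exists [::]; rewrite big_nil.
exists (s ++ [seq (- p.1, p.2) | p <- t]).
rewrite big_cat big_map -sumrN; congr (_ + _).
by apply: eq_bigr => p _; rewrite /= mulrNz mulNr.
Qed.
HB.instance Definition _ := GRing.isZmodClosed.Build R Ba Ba_zmod.

Record BaT := MkBa { Ba_val : R; Ba_valP : Ba_val \in Ba }.
HB.instance Definition _ := [isSub for Ba_val].
HB.instance Definition _ := [Choice of BaT by <:].
HB.instance Definition _ := [SubChoice_isSubZmodule of BaT by <:].

Fact Ba_act_subproof (n : int) (b : BaT) : a_ ^ n * Ba_val b \in Ba.
Proof.
case: b => b /= /BaP[s ->]; apply/BaP.
exists [seq (p.1, n + p.2) | p <- s].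
rewrite big_map mulr_sumr; apply: eq_bigr => p _ /=.
by rewrite expfzDr ?gt_eqF// mulrCA.
Qed.
Definition Ba_act n b := MkBa (Ba_act_subproof n b).

Fact Ba1_subproof : 1 \in Ba.
Proof. by apply/BaP; exists [:: (1, 0)]; rewrite big_seq1 expr0z mulr1. Qed.
Definition Ba1 := MkBa Ba1_subproof.

Record Ga := MkGa { Ga_trans : BaT; Ga_shift : int }.

Definition Ga_pair (g : Ga) := (Ga_trans g, Ga_shift g).
Definition pair_Ga (p : BaT * int) := MkGa p.1 p.2.
Fact Ga_pairK : cancel Ga_pair pair_Ga. Proof. by case. Qed.
HB.instance Definition _ := Choice.copy Ga (can_type Ga_pairK).

Definition Ga_one := MkGa 0 0.
Definition Ga_mul g h :=
  MkGa (Ga_trans g + Ba_act (Ga_shift g) (Ga_trans h))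
       (Ga_shift g + Ga_shift h).
Definition Ga_inv g :=
  MkGa (- Ba_act (- Ga_shift g) (Ga_trans g)) (- Ga_shift g).

Fact Ba_act0 b : Ba_act 0 b = b.
Proof. by apply: val_inj; rewrite /= expr0z mul1r. Qed.
Fact Ba_actA m n b : Ba_act m (Ba_act n b) = Ba_act (m + n) b.
Proof. by apply: val_inj; rewrite /= expfzDr ?gt_eqF// mulrA. Qed.
Fact Ba_actD n : {morph Ba_act n : b c / b + c}.
Proof. by move=> b c; apply: val_inj; rewrite /= mulrDr. Qed.
Fact Ba_actN n : {morph Ba_act n : b / - b}.
Proof. by move=> b; apply: val_inj; rewrite /= mulrN. Qed.
Fact Ba_actr0 n : Ba_act n 0 = 0.
Proof. by apply: val_inj; rewrite /= mulr0. Qed.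

Fact Ga_mulA : associative Ga_mul.
Proof.
move=> [b k] [c l] [d m]; congr MkGa => /=; last by rewrite addrA.
by rewrite Ba_actD Ba_actA addrA.
Qed.
Fact Ga_mul1 : left_id Ga_one Ga_mul.
Proof. by move=> [b k]; congr MkGa; rewrite /= ?Ba_act0 add0r. Qed.
Fact Ga_mulr1 : right_id Ga_one Ga_mul.
Proof. by move=> [b k]; congr MkGa; rewrite /= ?Ba_actr0 addr0. Qed.
Fact Ga_mulV : left_inverse Ga_one Ga_inv Ga_mul.
Proof. by move=> [b k]; congr MkGa; rewrite /= addNr. Qed.
Fact Ga_mulrV : right_inverse Ga_one Ga_inv Ga_mul.
Proof.
move=> [b k]; congr MkGa; rewrite /= ?subrr//.
by rewrite Ba_actN Ba_actA subrr Ba_act0 subrr.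
Qed.
HB.instance Definition _ :=
  isGroup.Build Ga Ga_mulA Ga_mul1 Ga_mulr1 Ga_mulV Ga_mulrV.

Definition Ga_u : Ga := MkGa 0 1.
Definition Ga_v : Ga := MkGa Ba1 0.

End GroupGa.

(* Main.v *)
(* [C^*(G_a)] has a faithful representation which is a direct sum of
   finite-dimensional ones: [G_a] is amenable and residually finite. Concretely,
   [G_a] acts on [nat] with finite orbits so that every finite subset of [G_a] is
   separated by some orbit map, and the permutation representation [pi] on
   [l^2(nat)] is faithful. Indeed, given a representation [rho], a vector [xi]
   and [s] in [C[G_a]], take a Foelner set [F] for the support of [s] and [n]
   with [f |-> f n] injective on [F]; for [e] in a finite orthonormal family put
     [c_e = \sum_(f in F) <rho(f^-1) xi, e> delta_(f n)].
   For [h] in the interior of [F] the coordinate of [pi(s) c_e] at [h n] is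
   [<rho(h^-1) rho(s) xi, e>], and summing over [e] and [h] bounds
   [|rho(s) xi|] by a constant times [|pi(s)| |xi|].

   The operator [D] is diagonal and constant on the finite orbits, so it commutes
   with the representation, and its eigenvalues can grow as fast as one likes:
   this gives (i) and (ii). For (iii), add to [D] the indicator of a set which is
   invariant under [v] but not under [u].

   Residual finiteness comes from ring morphisms from [Z[a, 1/a]] to prime fields
   which do not kill a given nonzero element. *)

From HB Require Import structures.
Require Import Defs.
From mathcomp Require Import all_boot all_order all_algebra complex.
From mathcomp Require Import ring zify.
From mathcomp Require Import all_classical all_reals all_analysis.

Set Implicit Arguments.
Unset Strict Implicit.
Unset Printing Implicit Defensive.

Import Order.TTheory GRing.Theory Num.Theory.
Import numFieldNormedType.Exports.

Local Open Scope classical_set_scope.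
Local Open Scope ring_scope.

(** * Limits and series of complex numbers *)

Section ComplexLimits.
Variable R : realType.
Local Notation C := (R[i]^o).

Lemma normc_ge_Im (z : C) : `|complex.Im z|%:C%C <= `|z|.
Proof.
rewrite normc_def lecR -sqrtr_sqr; apply: ler_wsqrtr.
by rewrite lerDr sqr_ge0.
Qed.

Lemma normc_le_ReIm (z : C) :
  `|z| <= (`|complex.Re z| + `|complex.Im z|)%:C%C.
Proof.
rewrite normc_def lecR -[leRHS]ger0_norm ?addr_ge0// -sqrtr_sqr.
apply: ler_wsqrtr; rewrite sqrrD !real_normK ?num_real//.
by rewrite addrAC lerDl mulrn_wge0 ?mulr_ge0.
Qed.

(** The bridge to real analysis: order limits, completeness and compactness of segments are carried
    over to [R[i]] by treating real and imaginary parts separately. *)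
Lemma cvg_complexP T (F : set_system T) {FF : Filter F} (f : T -> C) (l : C) :
  f @ F --> l <-> (fun t => complex.Re (f t)) @ F --> complex.Re l /\
                  (fun t => complex.Im (f t)) @ F --> complex.Im l.
Proof.
split=> [fl|[]].
  split; apply/cvgrPdist_lt => e e0.
    move/cvgrPdist_lt : fl => /(_ e%:C%C); rewrite ltcR => /(_ e0).
    apply: filterS => t; rewrite -ltcR; apply: le_lt_trans.
    by rewrite -[_ - _](raddfB (@complex.Re R)) normc_ge_Re.
  move/cvgrPdist_lt : fl => /(_ e%:C%C); rewrite ltcR => /(_ e0).
  apply: filterS => t; rewrite -ltcR; apply: le_lt_trans.
  by rewrite -[_ - _](raddfB (@complex.Im R)) normc_ge_Im.
move=> /cvgrPdist_lt fr /cvgrPdist_lt fi.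
apply/cvgrPdist_lt => e /complex_gt0_real[r r0 ->].
have r20 : 0 < r / 2 by rewrite divr_gt0.
near=> t; rewrite (le_lt_trans (normc_le_ReIm _))// ltcR.
rewrite (raddfB (@complex.Re R)) (raddfB (@complex.Im R)) [ltRHS]splitr ltrD//; near: t.
  exact: fr.
exact: fi.
Unshelve. all: by end_near. Qed.

Lemma cvg_conjc T (F : set_system T) {FF : Filter F} (f : T -> C) (l : C) :
  f @ F --> l -> (fun t => (f t)^*) @ F --> (l^* : C).
Proof.
move=> /cvgrPdist_lt fl; apply/cvgrPdist_lt => e /fl; apply: filterS => t.
by rewrite -rmorphB norm_conjC.
Qed.

(** Comparable elements of [R[i]] share their imaginary part: the bound makes the imaginary part of
    [f] eventually constant, and the real parts obey the order limit in [R]. *)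
Lemma limc_le T (F : set_system T) {FF : ProperFilter F} (f : T -> C) (l M : C) :
  f @ F --> l -> (\forall t \near F, f t <= M) -> l <= M.
Proof.
move=> /cvg_complexP[fr fi] fM; rewrite lecE; apply/andP; split.
  have fiM : (fun t => complex.Im (f t)) @ F --> complex.Im M.
    by apply: cvg_near_cst; apply: filterS fM => t; rewrite lecE => /andP[/eqP].
  by apply/eqP; exact: (cvg_unique _ fiM fi).
apply: (closed_cvg [set x | x <= complex.Re M]) fr; first exact: closed_le.
by apply: filterS fM => t; rewrite lecE => /andP[].
Qed.

Lemma limc_ge T (F : set_system T) {FF : ProperFilter F} (f : T -> C) (l M : C) :
  f @ F --> l -> (\forall t \near F, M <= f t) -> M <= l.
Proof.
move=> fl Mf; rewrite -lerN2.
have : (fun t => - f t) @ F --> - l by exact: cvgN.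
by move/limc_le; apply; apply: filterS Mf => t; rewrite lerN2.
Qed.

Lemma realc_sum I (r : seq I) (P : pred I) (F : I -> R) :
  (\sum_(i <- r | P i) F i)%:C%C = \sum_(i <- r | P i) (F i)%:C%C :> R[i].
Proof. exact: (raddf_sum (real_complex R)). Qed.

Lemma bounded_series_cvg (s : nat -> R) (M : R) : (forall n, 0 <= s n) ->
  (forall N, \sum_(n < N) s n <= M) -> cvgn (series s).
Proof.
move=> s0 sM; apply: nondecreasing_is_cvgn.
  apply/nondecreasing_seqP => n.
  by rewrite /series/= big_nat_recr//= lerDl.
by exists M => _ [n _ <-]; rewrite /series/= big_mkord.
Qed.

Lemma abs_series_cvg (z : nat -> C) (M : C) :
  (forall N, \sum_(n < N) `|z n| <= M) -> cvgn (series z).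
Proof.
move=> zM; have M0 : 0 <= M by have := zM 0%N; rewrite big_ord0.
(* Stated for any additive [f] dominated by the modulus, to serve the real and the imaginary part at
   once. *)
have H (f : {additive R[i] -> R}) : (forall x, `|f x|%:C%C <= `|x|) ->
    cvgn (series (fun n => f (z n))).
  move=> fle; apply: normed_cvg.
  apply: (@bounded_series_cvg _ (complex.Re M)) => [n|N]; first exact: normr_ge0.
  have : (\sum_(n < N) `|f (z n)|)%:C%C <= M.
    apply: le_trans (zM N); rewrite realc_sum; apply: ler_sum => i _; exact: fle.
  by rewrite lecE => /andP[].
have /cvg_ex[x xP] := H (@complex.Re R) (@normc_ge_Re R).
have /cvg_ex[y yP] := H (@complex.Im R) normc_ge_Im.
suff sl : series z @ \oo --> ((x +i* y)%C : C) by apply/cvg_ex; exists (x +i* y)%C.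
apply/cvg_complexP; split => /=.
  by apply: cvg_trans xP; apply: near_eq_cvg; near=> n; rewrite /series/= raddf_sum.
by apply: cvg_trans yP; apply: near_eq_cvg; near=> n; rewrite /series/= raddf_sum.
Unshelve. all: by end_near. Qed.

Lemma series_ge0_le (s : nat -> C) (l : C) N : (forall n, 0 <= s n) ->
  series s @ \oo --> l -> \sum_(n < N) s n <= l.
Proof.
move=> s0 sl; apply: (limc_ge sl); exists N => // n /= Nn.
rewrite /series/= -(big_mkord xpredT) (big_cat_nat (leq0n _) Nn) lerDl.
by apply: sumr_ge0.
Qed.

Lemma series_le (s : nat -> C) (l M : C) :
  series s @ \oo --> l -> (forall N, \sum_(n < N) s n <= M) -> l <= M.
Proof.
by move=> sl sM; apply: (limc_le sl); near=> n; rewrite /series/= big_mkord.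
Unshelve. all: by end_near. Qed.

End ComplexLimits.


(** * The Hilbert space of square summable sequences *)

Section PreHilbert.
Variables (R : realType) (U : lmodType R[i]) (d : {dot U for Num.conj}).

(** Needed at the level of the bare form, because the triangle inequality derived from it is what
    makes [ell2] a normed space. It is positivity at [u - k *: v], where [k *: v] is the projection
    of [u] on [v]. *)
Lemma dot_CauchySchwarz u v : `|d u v| <= sqrtC (d u u) * sqrtC (d v v).
Proof.
have [->|v0] := eqVneq v 0; first by rewrite linear0r normr0 mulr_ge0// sqrtC_ge0 dnorm_ge0.
have dv0 : 0 < d v v by rewrite dnorm_gt0.
rewrite -(@ler_pXn2r _ 2%N) ?nnegrE ?mulr_ge0 ?sqrtC_ge0 ?dnorm_ge0//.
rewrite exprMn !sqrtCK -ler_pdivrMr//.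
pose k := d u v / d v v.
have : 0 <= d (u - k *: v) (u - k *: v) by exact: dnorm_ge0.
rewrite dnormB dnormZ linearZr_LR/= normCK.
have -> : (k^* * d u v)^* = k * (d u v)^* by rewrite [LHS]rmorphM/= conjCK.
have kC : k^* = (d u v)^* / d v v.
  by rewrite /k [LHS]rmorphM/= fmorphV/= [(d v v)^*]conj_Creal ?ger0_real ?dnorm_ge0.
rewrite kC (_ : _ - _ = d u u - `|d u v| ^+ 2 / d v v) ?subr_ge0//.
by rewrite normCK /k; field; rewrite gt_eqF.
Qed.

Lemma dot_triangle u v :
  sqrtC (d (u + v) (u + v)) <= sqrtC (d u u) + sqrtC (d v v).
Proof.
have s0 x : 0 <= sqrtC (d x x) by rewrite sqrtC_ge0 dnorm_ge0.
rewrite -(@ler_pXn2r _ 2%N) ?nnegrE ?addr_ge0// sqrrD !sqrtCK dnormD.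
rewrite addrAC lerD2r lerD2l; apply: le_trans (real_ler_norm _) _.
  by apply/CrealP; rewrite rmorphD/= conjCK addrC.
rewrite (le_trans (ler_normD _ _))// norm_conjC -mulr2n lerMn2r/=.
exact: dot_CauchySchwarz.
Qed.
End PreHilbert.

Section Ell2.
Variable R : realType.
Local Notation C := (R[i]^o).
Implicit Types f g : nat -> C.

(** Bounded partial sums keep the closure properties at the level of finite sums. The bound [M] is
    automatically real and nonnegative, since it dominates the empty sum. *)
Definition sq_summable : {pred (nat -> C)} :=
  [pred f : nat -> C | `[< exists M : C, forall N, \sum_(n < N) `|f n| ^+ 2 <= M >]].

Lemma sq_summableP (f : nat -> C) : reflect
  (exists M : C, forall N, \sum_(n < N) `|f n| ^+ 2 <= M) (f \in sq_summable).
Proof. exact: asboolP. Qed.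

Lemma normc_sqrD (x y : R[i]) : `|x + y| ^+ 2 <= 2 * `|x| ^+ 2 + 2 * `|y| ^+ 2.
Proof.
apply: (@le_trans _ _ ((`|x| + `|y|) ^+ 2)).
  by rewrite ler_pXn2r ?nnegrE ?addr_ge0// ler_normD.
rewrite -subr_ge0 (_ : _ - _ = (`|x| - `|y|) ^+ 2); last by ring.
by rewrite real_exprn_even_ge0// realB ?normr_real.
Qed.

Lemma normc_mul_le (x y : R[i]) : `|x| * `|y| <= `|x| ^+ 2 + `|y| ^+ 2.
Proof.
rewrite -subr_ge0.
rewrite (_ : _ - _ = ((`|x| - `|y|) ^+ 2 + `|x| ^+ 2 + `|y| ^+ 2) / 2); last by field.
by rewrite divr_ge0// !addr_ge0 ?real_exprn_even_ge0 ?realB ?normr_real.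
Qed.

Fact sq_summable_submod : submod_closed sq_summable.
Proof.
split=> [|k f g /sq_summableP[M fM] /sq_summableP[M' gM]]; apply/sq_summableP.
  by exists 0 => N; rewrite big1// => i _; rewrite normr0 expr0n.
exists (2 * (`|k| ^+ 2 * M) + 2 * M') => N.
apply: (@le_trans _ _ (\sum_(n < N) (2 * (`|k| ^+ 2 * `|f n| ^+ 2) + 2 * `|g n| ^+ 2))).
  apply: ler_sum => n _; rewrite -exprMn -normrM; exact: normc_sqrD.
rewrite big_split/= -!mulr_sumr; apply: lerD; last exact: ler_wpM2l (gM N).
by apply: ler_wpM2l => //; apply: ler_wpM2l (fM N); exact: exprn_ge0.
Qed.

HB.instance Definition _ :=
  GRing.isSubmodClosed.Build R[i] (nat -> C) sq_summable sq_summable_submod.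

Record ell2 := Ell2 { ell2_val :> nat -> C; ell2_valP : ell2_val \in sq_summable }.
HB.instance Definition _ := [isSub for ell2_val].
HB.instance Definition _ := [Choice of ell2 by <:].
HB.instance Definition _ := [SubChoice_isSubLmodule of ell2 by <:].

Implicit Types u v w : ell2.

Lemma ell2_ext u v : (forall n, u n = v n) -> u = v.
Proof. by move=> uv; apply: val_inj; apply/funext. Qed.

Lemma ell2DE u v n : (u + v) n = u n + v n. Proof. by []. Qed.
Lemma ell2BE u v n : (u - v) n = u n - v n. Proof. by []. Qed.
Lemma ell2ZE k u n : (k *: u) n = k * u n. Proof. by []. Qed.
Lemma ell20E n : (0 : ell2) n = 0. Proof. by []. Qed.

Definition dot_term u v : nat -> C := fun n => u n * (v n)^*.

Definition ell2_dot u v : R[i] := limn (series (dot_term u v)).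

Lemma dot_term_cvg u v : cvgn (series (dot_term u v)).
Proof.
have /sq_summableP[M uM] := ell2_valP u; have /sq_summableP[M' vM] := ell2_valP v.
apply: (@abs_series_cvg _ _ (M + M')) => N; apply: le_trans (lerD (uM N) (vM N)).
rewrite -big_split/=; apply: ler_sum => n _.
by rewrite normrM norm_conjC normc_mul_le.
Qed.

Lemma ell2_dot_cvg u v : series (dot_term u v) @ \oo --> (ell2_dot u v : C).
Proof. exact: dot_term_cvg. Qed.

Lemma ell2_dot_lim u v (l : C) :
  series (dot_term u v) @ \oo --> l -> ell2_dot u v = l.
Proof. exact: cvg_lim. Qed.

Lemma ell2_dot_herm u v : ell2_dot u v = (-1) ^+ false * (ell2_dot v u)^*.
Proof.
rewrite expr0 mul1r; apply: ell2_dot_lim.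
apply: cvg_trans (cvg_conjc (@ell2_dot_cvg v u)).
apply: near_eq_cvg; near=> n; rewrite /series/= rmorph_sum/=.
by apply: eq_bigr => i _; rewrite /dot_term rmorphM/= conjCK mulrC.
Unshelve. all: by end_near. Qed.

Lemma ell2_dot_linearl w : linear_for *%R (ell2_dot^~ w).
Proof.
move=> k u v; have E : dot_term (k *: u + v) w = k *: dot_term u w + dot_term v w.
  by apply/funext => n; rewrite /dot_term ell2DE ell2ZE mulrDl -mulrA.
rewrite {1}/ell2_dot E lim_seriesD; first by rewrite lim_seriesZ//; exact: dot_term_cvg.
  by apply: is_cvg_seriesZ; exact: dot_term_cvg.
exact: dot_term_cvg.
Qed.

Lemma ell2_dot_linearr w : linear_for (Num.conj \; *%R) (ell2_dot w).
Proof.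
move=> k u v; have hC x y : ell2_dot x y = (ell2_dot y x)^*.
  by rewrite ell2_dot_herm expr0 mul1r.
by rewrite hC ell2_dot_linearl rmorphD rmorphM/= -!hC.
Qed.

HB.instance Definition _ := bilinear_isBilinear.Build R[i] ell2 ell2 R[i]
  *%R (Num.conj \; *%R) ell2_dot (ell2_dot_linearl, ell2_dot_linearr).
HB.instance Definition _ := isHermitianSesquilinear.Build R[i] ell2 false Num.conj
  ell2_dot ell2_dot_herm.

Lemma dot_termE u : dot_term u u = (fun n => `|u n| ^+ 2).
Proof. by apply/funext => n; rewrite /dot_term -normCK. Qed.

Lemma ell2_sum_le u N : \sum_(n < N) `|u n| ^+ 2 <= ell2_dot u u.
Proof.
have := @ell2_dot_cvg u u; rewrite dot_termE; apply: series_ge0_le => n.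
exact: exprn_ge0.
Qed.

Lemma ell2_le u (M : C) : (forall N, \sum_(n < N) `|u n| ^+ 2 <= M) ->
  ell2_dot u u <= M.
Proof. by move=> uM; have := @ell2_dot_cvg u u; rewrite dot_termE => /series_le; exact. Qed.

Lemma ell2_dot_gt0 u : u != 0 -> 0 < ell2_dot u u.
Proof.
move=> u0; have [n un] : exists n, u n != 0.
  apply: contrapT => /forallNP u00; case/eqP: u0; apply: ell2_ext => n.
  by rewrite ell20E; apply: contrapT => /eqP; exact: u00.
apply: lt_le_trans (ell2_sum_le u n.+1).
rewrite big_ord_recr/=; apply: ltr_wpDl; last by rewrite exprn_gt0// normr_gt0.
by apply: sumr_ge0 => i _; exact: exprn_ge0.
Qed.
HB.instance Definition _ := isDotProduct.Build R[i] ell2 ell2_dot ell2_dot_gt0.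

Definition ell2_norm u : R[i] := sqrtC (ell2_dot u u).

Lemma ell2_norm_triangle u v : ell2_norm (u + v) <= ell2_norm u + ell2_norm v.
Proof. exact: dot_triangle. Qed.

Lemma ell2_normZ k u : ell2_norm (k *: u) = `|k| * ell2_norm u.
Proof. by rewrite /ell2_norm dnormZ sqrtCM ?nnegrE ?exprn_ge0 ?dnorm_ge0// sqrCK. Qed.

Lemma ell2_norm0_eq0 u : ell2_norm u = 0 -> u = 0.
Proof. by move/eqP; rewrite sqrtC_eq0 dnorm_eq0 => /eqP. Qed.

HB.instance Definition _ := Lmodule_isNormed.Build R[i] ell2
  ell2_norm_triangle ell2_normZ ell2_norm0_eq0.

Lemma ell2_dotE u : ell2_dot u u = `|u| ^+ 2.
Proof. by rewrite /Num.norm/= /ell2_norm sqrtCK. Qed.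

Lemma ell2_norm_sum u N : \sum_(n < N) `|u n| ^+ 2 <= `|u| ^+ 2.
Proof. by rewrite -ell2_dotE; exact: ell2_sum_le. Qed.

Lemma ell2_norm_le u (M : R[i]) : 0 <= M ->
  (forall N, \sum_(n < N) `|u n| ^+ 2 <= M ^+ 2) -> `|u| <= M.
Proof.
move=> M0 uM; rewrite -(@ler_pXn2r _ 2%N) ?nnegrE// -ell2_dotE; exact: ell2_le.
Qed.

Lemma ell2_coord_le u n : `|u n| <= `|u|.
Proof.
rewrite -(@ler_pXn2r _ 2%N) ?nnegrE//; apply: le_trans (ell2_norm_sum u n.+1).
by rewrite big_ord_recr/= lerDr sumr_ge0// => i _; exact: exprn_ge0.
Qed.

End Ell2.


(** * Completeness of the space of square summable sequences *)

Section Ell2Complete.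
Variable R : realType.
Local Notation C := (R[i]^o).
Local Notation H := (ell2 R).

Lemma complexc_cauchy_cvg (F : set_system C) {FF : ProperFilter F} :
  (forall e : R[i], 0 < e -> exists2 A, F A & forall x y, A x -> A y -> `|x - y| < e) ->
  exists l : C, F --> l.
Proof.
move=> Fc.
have H (f : {additive R[i] -> R}) : (forall x, `|f x|%:C%C <= `|x|) -> cvg (f @ F).
  move=> fle; apply: cauchy_cvg; apply/cauchy_ballP => e e0.
  have [|A FA AP] := Fc e%:C%C; first by rewrite ltcR.
  exists (f @` A, f @` A) => /=.
    have FfA : F (f @^-1` (f @` A)) by apply: filterS FA => x Ax; exists x.
    by split.
  move=> [_ _] /= [[x Ax <-] [y Ay <-]]; rewrite -ball_normE/= -ltcR.
  by apply: le_lt_trans (AP x y Ax Ay); rewrite -raddfB fle.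
have /cvg_ex[x xP] := H (@complex.Re R) (@normc_ge_Re R).
have /cvg_ex[y yP] := H (@complex.Im R) (@normc_ge_Im R).
exists (x +i* y)%C; suff : id @ F --> ((x +i* y)%C : C) by [].
by apply/cvg_complexP; split.
Qed.

Lemma cvg_sum_ord T (F : set_system T) {FF : Filter F} N (f : 'I_N -> T -> C)
    (l : 'I_N -> C) : (forall n, f n @ F --> l n) ->
  (fun t => \sum_(n < N) f n t) @ F --> \sum_(n < N) l n.
Proof.
elim: N f l => [|N IH] f l fl.
  by rewrite big_ord0; under eq_fun do rewrite big_ord0; exact: cvg_cst.
rewrite big_ord_recr/=; under eq_fun do rewrite big_ord_recr/=.
by apply: cvgD; [apply: IH => n; exact: fl|exact: fl].
Qed.

Lemma sq_norm_cvg T (F : set_system T) {FF : Filter F} (f : T -> C) (l : C) :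
  f @ F --> l -> (fun t => `|f t| ^+ 2 : C) @ F --> (`|l| ^+ 2 : C).
Proof.
move=> fl; rewrite normCK; under eq_fun do rewrite normCK.
by apply: (@cvgM C); [|exact: cvg_conjc].
Qed.

(** A Fatou argument: for fixed [N] the truncated sum is continuous in finitely many coordinates, so
    the bound survives a coordinatewise limit. *)
Lemma ell2_coord_lim_le (F : set_system H) {FF : ProperFilter F} (l : nat -> C)
    (u : H) (e : R[i]) N : (forall n, (fun v : H => v n) @ F --> l n) ->
  (\forall v \near F, `|v - u| <= e) ->
  \sum_(n < N) `|l n - u n| ^+ 2 <= e ^+ 2.
Proof.
move=> Fl Fe.
have : (fun v : H => \sum_(n < N) (`|v n - u n| ^+ 2 : C)) @ F -->
       (\sum_(n < N) (`|l n - u n| ^+ 2 : C)).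
  apply: cvg_sum_ord => n; apply: sq_norm_cvg; apply: cvgB; [exact: Fl|exact: cvg_cst].
move/limc_le; apply; apply: filterS Fe => v ve.
apply: le_trans (ell2_norm_sum (v - u) N) _.
by rewrite ler_pXn2r ?nnegrE// (le_trans _ ve).
Qed.

(** The coordinatewise limit [l] is within [e] of every member of some set of the filter. This shows
    both that [l], as the sum of [l - u] and [u], is square summable, and that the filter converges
    to it in norm. *)
Fact ell2_cauchy_cvg (F : set_system H) : ProperFilter F -> cauchy F -> cvg F.
Proof.
move=> FF /cauchy_ballP Fc.
have Fc' (e : R[i]) : 0 < e -> exists2 A, F A & forall u v, A u -> A v -> `|u - v| < e.
  move=> /(Fc e) [[A B]]/= [FA FB] AB; exists (A `&` B); first exact: filterI.
  move=> u v [Au Bu] [Av Bv]; have := AB (u, v) (conj Au Bv).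
  by rewrite -ball_normE.
have /choice[l lP] : forall n, exists l : C, (fun v : H => v n) @ F --> l.
  move=> n; apply: complexc_cauchy_cvg => e /Fc'[A FA AP].
  exists ((fun v : H => v n) @` A).
    have : F ((fun v : H => v n) @^-1` ((fun v : H => v n) @` A)).
      by apply: filterS FA => v Av; exists v.
    by [].
  move=> _ _ [u Au <-] [v Av <-]; apply: le_lt_trans (AP u v Au Av).
  by rewrite -ell2BE ell2_coord_le.
have lF (e : R[i]) : 0 < e -> exists2 A, F A &
    forall u, A u -> forall N, \sum_(n < N) `|l n - u n| ^+ 2 <= e ^+ 2.
  move=> e0; have [A FA AP] := Fc' _ e0; exists A => // u Au N.
  apply: (@ell2_coord_lim_le F) => //.
  by apply: filterS FA => v Av; apply/ltW/AP.
have lin : (l : nat -> C) \in @sq_summable R.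
  have [A FA AP] := lF 1 ltr01; have [u Au] := filter_ex FA.
  have lu : (fun n => l n - u n) \in @sq_summable R.
    by apply/sq_summableP; exists (1 ^+ 2); exact: AP.
  rewrite (_ : l = (fun n => l n - u n) + ell2_val u); last first.
    by apply/funext => n; rewrite [RHS]subrK.
  by rewrite rpredD// ell2_valP.
apply/cvg_ex; exists (Ell2 lin); apply/cvgrPdist_le => e e0.
have [A FA AP] := lF _ e0; apply: filterS FA => u Au.
by apply: ell2_norm_le; [exact: ltW|exact: AP].
Qed.

HB.instance Definition _ := Uniform_isComplete.Build H ell2_cauchy_cvg.

Definition ell2_hilbert : hilbert R :=
  @Hilbert R H (@ell2_dot R) (@ell2_dotE R).

End Ell2Complete.


(** * Diagonal operators *)

Section Ell2Operators.
Variable R : realType.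
Local Notation C := (R[i]^o).
Local Notation H := (ell2_hilbert R).
Implicit Types (u v w : ell2 R) (c d : nat -> R).

Lemma ell2_le_coord u v (M : R[i]) : 0 <= M ->
  (forall n, `|u n| <= M * `|v n|) -> `|u| <= M * `|v|.
Proof.
move=> M0 uv; apply: ell2_norm_le => [|N]; first exact: mulr_ge0.
rewrite exprMn; apply: le_trans (ler_wpM2l _ (ell2_norm_sum v N)); last exact: exprn_ge0.
rewrite mulr_sumr; apply: ler_sum => n _; rewrite -exprMn.
by rewrite ler_pXn2r ?nnegrE ?mulr_ge0.
Qed.

Lemma ell2_dot_eq u v u' v' : (forall n, u n * (v n)^* = u' n * (v' n)^*) ->
  ell2_dot u v = ell2_dot u' v'.
Proof.
by move=> uv; rewrite /ell2_dot (_ : dot_term u v = dot_term u' v')//; exact/funext.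
Qed.

Lemma finite_support_sq_summable (f : nat -> C) N :
  (forall n, (N <= n)%N -> f n = 0) -> f \in @sq_summable R.
Proof.
move=> f0; apply/sq_summableP; exists (\sum_(n < N) `|f n| ^+ 2) => M.
rewrite -!(big_mkord xpredT (fun n => `|f n| ^+ 2)).
have le0 n m : 0 <= \sum_(n <= i < m) `|f i| ^+ 2.
  by apply: sumr_ge0 => i _; exact: exprn_ge0.
case: (leqP M N) => MN; first by rewrite (big_cat_nat (leq0n M) MN)/= lerDl.
rewrite (big_cat_nat (leq0n N) (ltnW MN))/= gerDl.
rewrite big_nat big1// => i /andP[Ni _].
by rewrite f0// normr0 expr0n.
Qed.

Definition delta_fun (n : nat) : nat -> C := fun m => (m == n)%:R.

Lemma delta_sq_summable n : delta_fun n \in @sq_summable R.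
Proof.
by apply: (@finite_support_sq_summable _ n.+1) => m nm; rewrite /delta_fun gtn_eqF.
Qed.

Definition delta n : ell2 R := Ell2 (delta_sq_summable n).

Lemma deltaE n m : delta n m = (m == n)%:R. Proof. by []. Qed.

Lemma dot_delta u n : ell2_dot u (delta n) = u n.
Proof.
apply: ell2_dot_lim; apply: cvg_near_cst; exists n.+1 => // N /= nN.
rewrite /series/= big_mkord (bigD1 (Ordinal nN))//= /dot_term deltaE eqxx rmorph1 mulr1.
rewrite big1 ?addr0// => i ni; have {}ni : (i == n :> nat) = false by exact: negbTE ni.
by rewrite /dot_term/= /delta_fun ni rmorph0 mulr0.
Qed.

Lemma ell2_dotC u v : ell2_dot u v = (ell2_dot v u)^*.
Proof. by rewrite ell2_dot_herm expr0 mul1r. Qed.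

(* [mul_dom c] is the natural domain of the multiplication by [c]; outside of
   it [mulop c] is [0]. *)
Definition mul_dom c u := ((fun n => (c n)%:C%C * u n) : nat -> C) \in @sq_summable R.

Definition mulop c u : ell2 R :=
  insubd (0 : ell2 R) ((fun n => (c n)%:C%C * u n) : nat -> C).

Lemma mulopE c u n : mul_dom c u -> mulop c u n = (c n)%:C%C * u n.
Proof. by move=> cu; rewrite /mulop -[ell2_val _]/(val _) insubdK. Qed.

Lemma mul_domP c u w : (forall n, w n = (c n)%:C%C * u n) ->
  mul_dom c u /\ mulop c u = w.
Proof.
move=> wE; have cu : mul_dom c u.
  by rewrite /mul_dom (_ : (fun n => _) = ell2_val w) ?ell2_valP//; apply/funext.
by split => //; apply: ell2_ext => n; rewrite mulopE.
Qed.

Lemma conj_realc (x : R) : (x%:C%C)^* = x%:C%C :> R[i].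
Proof. exact: conjc_real. Qed.

Lemma norm_realc (x : R) : `|x%:C%C : R[i]| = `|x|%:C%C.
Proof. by rewrite normc_def/= expr0n addr0 sqrtr_sqr. Qed.

Lemma bounded_mul_dom c (M : R) u : (forall n, `|c n| <= M) -> mul_dom c u.
Proof.
move=> cM; apply/sq_summableP; exists ((M ^+ 2)%:C%C * `|u| ^+ 2) => N.
have M0 : 0 <= M by exact: le_trans (cM 0%N).
apply: le_trans (ler_wpM2l _ (ell2_norm_sum u N)).
  rewrite mulr_sumr; apply: ler_sum => n _.
  rewrite normrM exprMn; apply: ler_wpM2r; first exact: exprn_ge0.
  by rewrite norm_realc -rmorphXn/= lecR ler_pXn2r ?nnegrE.
by rewrite lecR exprn_ge0.
Qed.

Definition bounded_bop (f : H -> H) (fl : linear f) (M : R[i])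
  (M0 : 0 < M) (fM : forall x, `|f x| <= M * `|x|) : bop H.
Proof.
apply: (Bop fl).
pose fL := GRing.isLinear.Build R[i] _ _ _ f fl.
pose f' : {linear _ -> _} := HB.pack f fL.
apply: (@bounded_linear_continuous _ _ _ f'); apply/linear_boundedP.
exists M; split; first exact: gtr0_real.
by move=> r Mr v; rewrite (le_trans (fM v))// ler_wpM2r// ltW.
Defined.

Section Diag.
Variables (c : nat -> R) (M : R).
Hypothesis cM : forall n, `|c n| <= M.

Lemma mulop_boundedE u n : mulop c u n = (c n)%:C%C * u n.
Proof. by apply: mulopE; exact: bounded_mul_dom cM. Qed.

Lemma mulop_linear : linear (mulop c).
Proof.
move=> k u v; apply: ell2_ext => n.
by rewrite ell2DE ell2ZE !mulop_boundedE ell2DE ell2ZE mulrDr mulrCA.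
Qed.

(** The constant is [M + 1] because [bounded_bop] asks for a positive one, while [M] may be [0]. *)
Lemma diag_bound_gt0 : 0 < (M + 1)%:C%C :> R[i].
Proof. by rewrite ltcR ltr_wpDl// (le_trans _ (cM 0%N)). Qed.

Lemma mulop_le u : `|mulop c u| <= (M + 1)%:C%C * `|u|.
Proof.
apply: ell2_le_coord => [|n]; first exact/ltW/diag_bound_gt0.
rewrite mulop_boundedE normrM ler_wpM2r// norm_realc lecR.
by rewrite (le_trans (cM n))// lerDl.
Qed.

Definition diag : bop H := bounded_bop mulop_linear diag_bound_gt0 mulop_le.

Lemma diagE (u : H) n : ell2_val (diag u) n = (c n)%:C%C * ell2_val u n.
Proof. exact: mulop_boundedE. Qed.

End Diag.

Section DiagonalUnbounded.
Variable d : nat -> R.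

Fact mul_dom0 : mul_dom d 0.
Proof. by apply: (@finite_support_sq_summable _ 0%N) => n _; rewrite mulr0. Qed.

Lemma mul_dom_comb (k : R[i]) u v : mul_dom d u -> mul_dom d v ->
  mul_dom d (k *: u + v) /\ mulop d (k *: u + v) = k *: mulop d u + mulop d v.
Proof.
move=> du dv; apply: mul_domP => n.
by rewrite !ell2DE !ell2ZE !mulopE// mulrDr mulrCA.
Qed.

Definition diag_op : unbounded_op H :=
  @UnboundedOp R H (mul_dom d) (mulop d) mul_dom0
    (fun k u v du dv => proj1 (mul_dom_comb k du dv))
    (fun k u v du dv => proj2 (mul_dom_comb k du dv)).

Lemma ell2_tail u (e : R[i]) : 0 < e ->
  exists N, forall M, \sum_(N <= n < M) `|u n| ^+ 2 <= e.
Proof.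
move=> e0; have : series (dot_term u u) @ \oo --> (ell2_dot u u : C) by exact: ell2_dot_cvg.
rewrite dot_termE ell2_dotE => ul.
move/cvgrPdist_lt : (ul) => /(_ _ e0)[N _ /(_ N (leqnn N))/= uN].
have uMN M : \sum_(0 <= n < M) `|u n| ^+ 2 <= `|u| ^+ 2.
  by rewrite big_mkord; exact: ell2_norm_sum.
exists N => M; apply: le_trans (ltW uN).
rewrite ger0_norm; last by rewrite subr_ge0; exact: uMN.
case: (leqP M N) => MN; first by rewrite big_geq// subr_ge0; exact: uMN.
rewrite lerBrDl; apply: le_trans (uMN M).
by rewrite (big_cat_nat (leq0n N) (ltnW MN)).
Qed.

Lemma truncation_le u (e : R[i]) : 0 < e -> exists N,
  `|u - mulop (fun n => (n < N)%N%:R) u| < e.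
Proof.
move=> e0; have e20 : 0 < (e / 2) ^+ 2 by rewrite exprn_gt0// divr_gt0.
have [N uN] := ell2_tail u e20; exists N.
apply: (@le_lt_trans _ _ (e / 2)); last by rewrite ltr_pdivrMr// ltr_pMr// ltr1n.
apply: ell2_norm_le => [|M]; first by rewrite ltW// divr_gt0.
have E n : (u - mulop (fun n => (n < N)%N%:R) u) n = (N <= n)%N%:R * u n.
  rewrite ell2BE (@mulop_boundedE _ 1) => [|m]; last first.
    by case: ltnP => _; rewrite ?normr0 ?normr1.
  by case: ltnP => _; rewrite ?mul1r ?mul0r ?subrr ?subr0.
move: (u - _) E => w E; apply: le_trans (uN M).
rewrite -(big_mkord xpredT (fun n => `|w n| ^+ 2)).
have z M' : (M' <= N)%N -> \sum_(0 <= n < M') `|w n| ^+ 2 = 0.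
  move=> MN; rewrite big_nat big1// => i /andP[_ iM].
  by rewrite E leqNgt (leq_trans iM MN) mul0r normr0 expr0n.
case: (leqP M N) => MN; first by rewrite z// sumr_ge0// => i _; exact: exprn_ge0.
rewrite (big_cat_nat (leq0n N) (ltnW MN))/= z// add0r !big_nat.
by apply: ler_sum => i /andP[Ni _]; rewrite E Ni mul1r.
Qed.

(** Truncations are finitely supported, hence in the domain of every multiplication operator, and
    they approximate any vector. *)
Lemma diag_op_dense : dense (uop_dom diag_op).
Proof.
move=> O [u Ou] oO.
have /nbhs_ballP[e /= e0 eO] : nbhs u O by exact: open_nbhs_nbhs.
have [N uN] := truncation_le u e0.
exists (mulop (fun n => (n < N)%N%:R) u); split.
  by apply: eO; rewrite -ball_normE.
apply: (@finite_support_sq_summable _ N) => n Nn.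
rewrite (@mulop_boundedE _ 1) => [|m]; last by case: ltnP => _; rewrite ?normr0 ?normr1.
by rewrite ltnNge Nn mul0r mulr0.
Qed.

Lemma mulop_delta n : mul_dom d (delta n) /\
  mulop d (delta n) = (d n)%:C%C *: delta n.
Proof.
apply: mul_domP => m; rewrite ell2ZE deltaE; case: eqVneq => [->//|_].
by rewrite !mulr0.
Qed.

(** Testing the adjoint relation on the vectors [delta n] forces [z n = d n * w n], so [w] lies in
    the domain: it is here that the domain has to be the maximal one. The other direction holds
    because [d] is real. *)
Lemma diag_op_selfadjoint : selfadjoint diag_op.
Proof.
split; first exact: diag_op_dense.
move=> w z; split=> [adj|[/= dw <-] v dv]; last first.
  apply: ell2_dot_eq => n; rewrite !mulopE// rmorphM/= conj_realc.
  by rewrite mulrCA mulrA.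
have [|dw zE] := @mul_domP d w z; last by [].
move=> n; have [dn dE] := mulop_delta n.
have := adj (delta n) dn; rewrite /= dE => dz.
have : ell2_dot z (delta n) = (d n)%:C%C * ell2_dot w (delta n).
  rewrite ell2_dotC [in RHS]ell2_dotC; rewrite /= in dz.
  by rewrite -dz linearZl_LR/= rmorphM/= conj_realc.
by rewrite !dot_delta.
Qed.

End DiagonalUnbounded.
End Ell2Operators.


(** * Compactness, resolvents and summability of diagonal operators *)

Section DiagonalResolvent.
Variable R : realType.
Local Notation C := (R[i]^o).
Local Notation H := (ell2_hilbert R).

Lemma ultra_fmap T U (F : set_system T) (f : T -> U) :
  UltraFilter F -> UltraFilter (f @ F).
Proof.
move=> FU; have FP : ProperFilter F by exact: ultra_proper.
split=> [|G GP fG]; first exact: fmap_proper_filter.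
apply/seteqP; split=> // A GA.
have [//|FnA] := in_ultra_setVsetC (f @^-1` A) FU.
have GnA : G (~` A) by exact: fG.
by have /filter_ex[x []] : G (A `&` ~` A) by exact: filterI.
Qed.

Lemma ultra_bounded_cvg (F : set_system C) (M : R[i]) : UltraFilter F ->
  F [set z | `|z| <= M] -> exists l : C, F --> l.
Proof.
move=> FU FM; have FP : ProperFilter F by exact: ultra_proper.
have M0 : 0 <= M by have [z /= zM] := filter_ex FM; exact: le_trans zM.
have H (f : R[i] -> R) : (forall x, `|f x|%:C%C <= `|x|) -> exists y : R, f @ F --> y.
  move=> fle; have := @segment_compact R (- complex.Re M) (complex.Re M).
  rewrite compact_ultra => /(_ (f @ F) (ultra_fmap _ FU)) []; last first.
    by move=> y [_ fy]; exists y.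
  have : F (f @^-1` [set` `[- complex.Re M, complex.Re M]]); last by [].
  apply: filterS FM => z /= zM; rewrite in_itv/= -ler_norml.
  by move: (le_trans (fle z) zM); rewrite lecE => /andP[].
have [x xP] := H (@complex.Re R) (@normc_ge_Re R).
have [y yP] := H (@complex.Im R) (@normc_ge_Im R).
exists (x +i* y)%C; suff : id @ F --> ((x +i* y)%C : C) by [].
by apply/cvg_complexP; split.
Qed.

(** An ultrafilter on the cube converges in each coordinate, the coordinates being bounded. Since
    [s] is square summable, the tails of the points of the cube are uniformly small, and
    coordinatewise convergence becomes norm convergence. *)
Lemma hilbert_cube_compact (s : ell2 R) :
  compact [set v : ell2 R | forall n, `|v n| <= `|s n|].
Proof.
rewrite compact_ultra => F FU FC; have FP : ProperFilter F by exact: ultra_proper.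
have /choice[l lP] : forall n, exists l : C, (fun v : ell2 R => v n) @ F --> l.
  move=> n; apply: (@ultra_bounded_cvg _ `|s n|); first exact: ultra_fmap.
  have : F ((fun v : ell2 R => v n) @^-1` [set z | `|z| <= `|s n|]); last by [].
  by apply: filterS FC => v; exact.
have ls n : `|l n| ^+ 2 <= `|s n| ^+ 2.
  apply: (limc_le (sq_norm_cvg (lP n))); apply: filterS FC => v vC.
  by rewrite ler_pXn2r ?nnegrE.
have lin : (l : nat -> C) \in @sq_summable R.
  have /sq_summableP[M sM] := ell2_valP s; apply/sq_summableP; exists M => N.
  by apply: le_trans (sM N); apply: ler_sum => n _.
exists (Ell2 lin); split => [n /=|]; first by rewrite -(@ler_pXn2r _ 2%N) ?nnegrE.
apply/cvgrPdist_le => e e0.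
(* Head and tail get half of [e ^+ 2] each; in the tail, [|l n - v n| ^+ 2] is at most
   [2 * |l n| ^+ 2 + 2 * |v n| ^+ 2], hence at most [4 * |s n| ^+ 2]. *)
have e80 : 0 < e ^+ 2 / 2 / 4 by rewrite !divr_gt0// exprn_gt0.
have [N sN] := ell2_tail s e80.
have : (fun v : ell2 R => \sum_(n < N) (`|l n - v n| ^+ 2 : C)) @ F -->
    (\sum_(n < N) (`|l n - l n| ^+ 2 : C)).
  by apply: cvg_sum_ord => n; apply: sq_norm_cvg; apply: cvgB (lP n); exact: cvg_cst.
rewrite big1 => [|n _]; last by rewrite subrr normr0 expr0n.
have e20 : 0 < e ^+ 2 / 2 by rewrite divr_gt0// exprn_gt0.
move/cvgrPdist_le => /(_ _ e20) Fe.
apply: filterS (filterI FC Fe) => v [/= vC]; rewrite sub0r normrN.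
have le0 (f : nat -> C) n m : 0 <= \sum_(n <= i < m) `|f i| ^+ 2.
  by apply: sumr_ge0 => i _; exact: exprn_ge0.
rewrite -(big_mkord xpredT (fun n => `|l n - v n| ^+ 2)) ger0_norm ?le0// => lvN.
apply: ell2_norm_le => [|M]; first exact: ltW.
rewrite -(big_mkord xpredT (fun n => `|l n - v n| ^+ 2)).
case: (leqP M N) => MN.
  apply: (@le_trans _ _ (\sum_(0 <= n < N) `|l n - v n| ^+ 2)).
    by rewrite [leRHS](big_cat_nat (leq0n M) MN)/= lerDl le0.
  by apply: le_trans lvN _; rewrite ler_pdivrMr// ler_peMr ?ler1n// exprn_ge0// ltW.
rewrite (big_cat_nat (leq0n N) (ltnW MN))/= [leRHS]splitr lerD//.
apply: (@le_trans _ _ (\sum_(N <= n < M) `|s n| ^+ 2 * 4)).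
  apply: ler_sum => n _; apply: le_trans (normc_sqrD _ _) _; rewrite normrN.
  have sv : `|v n| ^+ 2 <= `|s n| ^+ 2 by rewrite ler_pXn2r ?nnegrE.
  apply: le_trans (lerD (ler_wpM2l _ (ls n)) (ler_wpM2l _ sv)) _ => //.
  by rewrite -mulrDl mulrC -natrD.
by rewrite -mulr_suml -ler_pdivlMr.
Qed.

(** Coordinates of a vector of the unit ball have modulus at most [1], so its image lies in the
    Hilbert cube with sides [c n]. *)
Lemma diag_compact (c : nat -> R) (M : R) (cM : forall n, `|c n| <= M) :
  ((fun n => (c n)%:C%C) : nat -> C) \in @sq_summable R -> compact_op (diag cM).
Proof.
move=> cs; rewrite /compact_op.
have : precompact [set v : ell2 R | forall n, `|v n| <= `|Ell2 cs n|].
  by apply: compact_precompact; [exact: norm_hausdorff|exact: hilbert_cube_compact].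
apply: (@precompact_subset (ell2 R)) => _ [v /= v1 <-] n.
rewrite (diagE cM v n) normrM ler_piMr//.
exact: le_trans (ell2_coord_le v n) v1.
Qed.

Section Resolvent.
Variable d : nat -> R.
Hypothesis d_ge : forall n, 2 ^+ n <= d n.

Let k n := (1 + d n ^+ 2)^-1.

Let kden_gt0 n : 0 < 1 + d n ^+ 2.
Proof. by rewrite ltr_pwDl// sqr_ge0. Qed.

Let k_ge0 n : 0 <= k n. Proof. by rewrite invr_ge0 ltW. Qed.

Let d_gt0 n : 0 < d n.
Proof. by apply: lt_le_trans (d_ge n); rewrite exprn_gt0. Qed.

(** Together with [ddk_le1] this makes [D K] and [D^2 K] bounded multiplications, so that the range
    of the resolvent lies in the domain of [D^2]. The difference is exhibited as a sum of
    squares. *)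
Let dk_le1 n : d n * k n <= 1.
Proof.
rewrite ler_pdivrMr// mul1r -subr_ge0.
rewrite (_ : _ - _ = ((d n - 1) ^+ 2 + d n ^+ 2 + 1) / 2); last by field.
by rewrite divr_ge0// addr_ge0// addr_ge0 ?sqr_ge0.
Qed.

Let k_le1 n : `|k n| <= 1.
Proof.
by rewrite ger0_norm// invf_le1// lerDl sqr_ge0.
Qed.

Let ddk_le1 n : d n * (d n * k n) <= 1.
Proof.
by rewrite mulrA -expr2 ler_pdivrMr// mul1r lerDr.
Qed.

Definition resolvent : bop H := diag k_le1.

Lemma resolventP : is_resolvent (diag_op d) resolvent.
Proof.
have D1 (w : H) : mul_dom d (resolvent w).
  rewrite /mul_dom (_ : (fun n => _) = (fun n => (d n * k n)%:C%C * ell2_val w n)).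
    apply: (@bounded_mul_dom _ (fun n => d n * k n) 1) => n.
    by rewrite ger0_norm// mulr_ge0// ltW.
  by apply/funext => n; rewrite diagE mulrA -rmorphM.
have D2 (w : H) : mul_dom d (mulop d (resolvent w)).
  rewrite /mul_dom (_ : (fun n => _) = (fun n => (d n * (d n * k n))%:C%C * ell2_val w n)).
    apply: (@bounded_mul_dom _ (fun n => d n * (d n * k n)) 1) => n.
    by rewrite ger0_norm// mulr_ge0 ?ltW// mulr_gt0// invr_gt0.
  by apply/funext => n; rewrite mulopE// diagE !rmorphM/= !mulrA.
split=> [w|v dv ddv]; first split; [exact: D1|exact: D2| |].
  apply: ell2_ext => n; rewrite ell2DE (mulopE _ (D2 w)) (mulopE _ (D1 w)).
  rewrite (diagE k_le1 w n) !mulrA -mulrDl -[RHS]mul1r; congr (_ * _).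
  rewrite -!rmorphM/= -rmorphD/= -expr2 -[X in X + _]mul1r -mulrDl mulfV//.
  by rewrite gt_eqF.
apply: ell2_ext => n; rewrite (diagE k_le1 _ n) ell2DE (mulopE _ ddv) (mulopE _ dv).
rewrite mulrDr !mulrA -mulrDl -[RHS]mul1r; congr (_ * _).
rewrite -!rmorphM/= -rmorphD/= -[X in X + _]mulr1 -mulrA -expr2 -mulrDr mulVf//.
by rewrite gt_eqF.
Qed.

Lemma sum_half_le N : \sum_(n < N) (2^-1 : R) ^+ n <= 2.
Proof.
suff -> : \sum_(n < N) (2^-1 : R) ^+ n = 2 - 2 * 2^-1 ^+ N.
  by rewrite gerBl mulr_ge0// exprn_ge0// invr_ge0.
elim: N => [|N IH]; first by rewrite big_ord0 expr0 mulr1 subrr.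
by rewrite big_ord_recr/= IH exprS; field.
Qed.

Let k_le n : k n <= 2^-1 ^+ n.
Proof.
rewrite exprVn lef_pV2 ?posrE ?exprn_gt0//.
apply: (le_trans (d_ge n)); rewrite -subr_ge0.
rewrite (_ : _ - _ = ((d n - 1) ^+ 2 + d n ^+ 2 + 1) / 2); last by field.
by rewrite divr_ge0// addr_ge0// addr_ge0 ?sqr_ge0.
Qed.

Lemma resolvent_compact : compact_op resolvent.
Proof.
apply: diag_compact; apply/sq_summableP; exists 2%:C%C => N.
under eq_bigr do rewrite norm_realc -rmorphXn/=.
rewrite -realc_sum lecR; apply: le_trans (sum_half_le N).
apply: ler_sum => n _; apply: le_trans (k_le n).
by rewrite expr2 ger0_norm// ler_piMr// -[k n]ger0_norm.
Qed.

Lemma diag_expE (c : nat -> R) (M : R) (cM : forall n, `|c n| <= M) j (v : H) n :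
  ell2_val ((diag cM ^+ j) v) n = (c n ^+ j)%:C%C * ell2_val v n.
Proof.
elim: j v => [|j IH] v; first by rewrite !expr0 mul1r.
have -> : (diag cM ^+ j.+1) v = diag cM ((diag cM ^+ j) v) by rewrite exprS.
by rewrite (diagE cM) IH exprS rmorphM/= mulrA.
Qed.

Lemma ell2_sumE I (r : seq I) (F : I -> ell2 R) n :
  ell2_val (\sum_(i <- r) F i) n = \sum_(i <- r) ell2_val (F i) n.
Proof.
elim: r => [|i r IH]; first by rewrite !big_nil ell20E.
by rewrite !big_cons ell2DE IH.
Qed.

Lemma poly_op_diagE (c : nat -> R) (M : R) (cM : forall n, `|c n| <= M)
    (q : {poly R}) (v : H) n :
  ell2_val (poly_op q (diag cM) v) n = (q.[c n])%:C%C * ell2_val v n.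
Proof.
rewrite /poly_op bop_sumE ell2_sumE horner_coef realc_sum mulr_suml.
by apply: eq_bigr => i _; rewrite ell2ZE diag_expE rmorphM/= mulrA.
Qed.

(** On a diagonal operator a polynomial acts entrywise, and the norm of a diagonal operator is at
    most the supremum of its entries; so the tolerance [d := e] works. *)
Lemma diag_funcalc (c : nat -> R) (M M' : R) (f : R -> R)
    (cM : forall n, `|c n| <= M) (fcM : forall n, `|f (c n)| <= M') :
  (forall n, 0 <= c n <= 1) -> is_funcalc f (diag cM) (diag fcM).
Proof.
move=> c01 e e0; exists e => // q qf v.
apply: ell2_le_coord => [|n]; first by rewrite lecR ltW.
rewrite ell2BE poly_op_diagE diagE -mulrBl -rmorphB/= normrM ler_wpM2r//.
by rewrite norm_realc lecR; apply: qf.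
Qed.

Lemma delta_inj : injective (@delta R).
Proof.
move=> n m /(congr1 (fun u : ell2 R => u n)); rewrite !deltaE eqxx.
by case: eqVneq => // _ /eqP; rewrite oner_eq0.
Qed.

Lemma delta_basis : @orthonormal_basis R H (range (@delta R)).
Proof.
split=> [_ _ [n _ <-] [m _ <-]|v v0].
  rewrite -[LHS]/(ell2_dot (delta R n) (delta R m)) dot_delta deltaE.
  have [->|nm] := eqVneq m n; first by rewrite eqxx.
  by have [/delta_inj/esym/eqP|//] := eqVneq (delta R n) (delta R m); rewrite (negbTE nm).
apply: ell2_ext => n; rewrite -[LHS]dot_delta.
by apply: v0; exists n.
Qed.

(** For [1 <= p] the eigenvalue [k n] to the power [p / 2] is at most its square root, hence at most
    the inverse of [d n] and at most [2^-n]. A single [d] thus serves all exponents. *)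
Lemma diag_op_summable (p : R) : 1 <= p -> summable_op p (diag_op d).
Proof.
move=> p1; have p0 : 0 <= p / 2 by rewrite divr_ge0// (le_trans ler01).
have kp n : k n `^ (p / 2) <= 2^-1 ^+ n.
  rewrite /k -powR_inv1 ?(ltW (kden_gt0 n))// -powRrM mulN1r powRN exprVn.
  rewrite lef_pV2 ?posrE ?powR_gt0 ?exprn_gt0//.
  apply: (@le_trans _ _ ((1 + d n ^+ 2) `^ (2^-1))).
    rewrite powR12_sqrt ?(ltW (kden_gt0 n))//; apply: le_trans (d_ge n) _.
    rewrite -[leLHS]ger0_norm ?(ltW (d_gt0 n))// -sqrtr_sqr.
    by apply: ler_wsqrtr; rewrite lerDr.
  by apply: ler_powR; rewrite ?lerDl ?sqr_ge0// ler_pdivlMr// mulVf.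
have kp1 n : `|k n `^ (p / 2)| <= 1.
  rewrite ger0_norm ?powR_ge0//; apply: le_trans (kp n) _.
  by rewrite exprn_ile1 ?invr_ge0// invf_le1// ler1n.
exists resolvent, (diag kp1), (range (@delta R)); split.
- exact: resolventP.
- apply: (@diag_funcalc _ _ _ (fun t => t `^ (p / 2))) => n.
  by apply/andP; split; [exact: k_ge0 | exact: le_trans (ler_norm _) (k_le1 n)].
- exact: delta_basis.
- rewrite /op_trace esum_image; last by move=> ? ? _ _; exact: delta_inj.
  have E n : complex.Re (ell2_dot (diag kp1 (delta R n)) (delta R n)) = k n `^ (p / 2).
    by rewrite dot_delta diagE deltaE eqxx mulr1.
  under eq_esum => n _ do rewrite E.
  have -> : [set: nat] = [set x | xpredT x] by apply/seteqP; split.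
  rewrite -nneseries_esum; last first.
    by move=> n _; rewrite lee_fin powR_ge0.
  (* The bound [2^-n] is written [2 / 2 ^ (n + 1)] to match a geometric series whose sum is
     known. *)
  apply: (@le_lt_trans _ _ (\sum_(0 <= n <oo) (2 / (2 ^ (n + 1))%:R)%:E)%E).
    apply: lee_nneseries => n _; first by rewrite lee_fin powR_ge0.
    rewrite lee_fin (le_trans (kp n))// natrX addn1 exprS invfM mulrA mulfV// mul1r.
    by rewrite exprVn.
  by rewrite (cvg_lim _ (@cvg_geometric_eseries_half R 2 0))// ltry.
Qed.

End Resolvent.
End DiagonalResolvent.


(** * Permutation representations *)

Section EvaluationRep.
Variables (R : realType) (G : groupType) (rho : unitary_rep R G).

(** The full group algebra sits in the product over all unitary representations, so projecting on
    the coordinate [rho] extends [rho] to it. *)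
Definition eval_rep : cstar_rep G (urep_space rho).
Proof.
apply: (@CstarRep R G (urep_space rho) (fun x => x rho)) => //.
- by rewrite /gc_one /= /rep_sum big_seq1 scale1r urep1.
- by move=> x v w; exact: gc_starP.
Defined.

Lemma eval_rep_elt g : eval_rep (gc_elt R g) = rho g.
Proof. by rewrite /= /rep_sum big_seq1 scale1r. Qed.

Lemma small_norm_eq0 (H : hilbert R) (w : H) (K : R[i]) : 0 < K ->
  (forall e : R[i], 0 < e -> `|w| <= e * K) -> w = 0.
Proof.
move=> K0 wK; apply/eqP; rewrite -normr_eq0; apply/negPn/negP => w0.
have {}w0 : 0 < `|w| by rewrite lt_def w0 normr_ge0.
have := wK (`|w| / K / 2); rewrite !divr_gt0// => /(_ isT).
rewrite mulrAC divfK ?gt_eqF// => ww; suff : `|w| < `|w| by rewrite ltxx.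
by apply: le_lt_trans ww _; rewrite ltr_pdivrMr// ltr_pMr// ltr1n.
Qed.

Lemma rep_sum_commute (T : bop (urep_space rho)) s :
  (forall g, T * rho g = rho g * T) -> T * rep_sum rho s = rep_sum rho s * T.
Proof.
move=> Tr; rewrite /rep_sum mulr_sumr mulr_suml; apply: eq_bigr => c _.
by rewrite bop_scaleAr bop_scaleAl Tr.
Qed.

(** Commutation with the group elements passes to their linear combinations, then to norm limits. *)
Lemma gc_commute (T : bop (urep_space rho)) (x : group_cstar R G) :
  (forall g, T * rho g = rho g * T) -> T * x rho = x rho * T.
Proof.
move=> Tr; apply: bop_ext => v; rewrite -[LHS]/(T (x rho v)) -[RHS]/(x rho (T v)).
apply/eqP; rewrite -subr_eq0; apply/eqP.
have [M M0 TM] := bop_bounded T.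
(* One summand for each replacement of [x rho] by a finite sum; the [+ 1] keeps the constant
   positive when [v] is [0]. *)
apply: (@small_norm_eq0 _ _ (M * (`|v| + 1) + M * (`|v| + 1))).
  by rewrite addr_gt0// mulr_gt0// ltr_wpDl.
move=> e e0; have [s xs] := gc_approx x e0.
have sT : T (rep_sum rho s v) = rep_sum rho s (T v).
  by have := congr1 (fun S : bop _ => S v) (rep_sum_commute s Tr).
rewrite -(subrKA (T (rep_sum rho s v))) -linearB mulrDr.
apply: le_trans (ler_normD _ _) _; apply: lerD.
  apply: le_trans (TM _) _; rewrite mulrCA ler_wpM2l ?(ltW M0)//.
  by apply: le_trans (xs _ _) _; rewrite ler_wpM2l ?(ltW e0)// lerDl.
rewrite sT distrC; apply: le_trans (xs _ _) _; rewrite ler_wpM2l ?(ltW e0)//.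
by apply: le_trans (TM _) _; rewrite ler_wpM2l ?(ltW M0)// lerDl.
Qed.

End EvaluationRep.

Section PermutationRep.
Variables (R : realType) (G : groupType) (act : G -> nat -> nat).
Hypothesis act1 : forall n, act 1%g n = n.
Hypothesis actM : forall g h n, act (g * h)%g n = act g (act h n).
Local Notation C := (R[i]^o).
Local Notation H := (ell2_hilbert R).

Lemma actK g : cancel (act g) (act g^-1%g).
Proof. by move=> n; rewrite -actM mulVg act1. Qed.

Lemma actVK g : cancel (act g^-1%g) (act g).
Proof. by move=> n; rewrite -actM mulgV act1. Qed.

(** The first [N] values of [s] are distinct and lie below some [N'], so the sum is part of a longer
    partial sum of nonnegative terms. *)
Lemma sum_inj_le (F : nat -> R[i]) (M : R[i]) (s : nat -> nat) N : injective s ->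
  (forall n, 0 <= F n) -> (forall N', \sum_(n < N') F n <= M) ->
  \sum_(n < N) F (s n) <= M.
Proof.
move=> sI F0 FM; pose N' := (\max_(n < N) s n).+1.
have sN (n : 'I_N) : (s n < N')%N by rewrite ltnS; exact: leq_bigmax.
pose h (n : 'I_N) := Ordinal (sN n).
have hI : {in xpredT &, injective h}.
  by move=> i j _ _ /(congr1 val)/= /sI; exact: val_inj.
rewrite -[leLHS](big_imset (fun j : 'I_N' => F j) hI).
apply: le_trans (FM N'); rewrite [leRHS](bigID (mem (h @: 'I_N)))/= lerDl.
exact: sumr_ge0.
Qed.

Lemma perm_sum_le g (u : ell2 R) N : \sum_(n < N) `|u (act g n)| ^+ 2 <= `|u| ^+ 2.
Proof.
apply: (@sum_inj_le (fun n => `|u n| ^+ 2)) => [|n|M].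
- exact: can_inj (actK g).
- exact: exprn_ge0.
- exact: ell2_norm_sum.
Qed.

Fact perm_sq_summable g (u : ell2 R) :
  (fun n => u (act g^-1%g n)) \in @sq_summable R.
Proof. by apply/sq_summableP; exists (`|u| ^+ 2) => N; exact: perm_sum_le. Qed.

Definition perm_fun g (u : ell2 R) : ell2 R := Ell2 (perm_sq_summable g u).

Lemma perm_funE g u n : perm_fun g u n = u (act g^-1%g n). Proof. by []. Qed.

Fact perm_linear g : linear (perm_fun g).
Proof. by move=> k u v; apply: ell2_ext. Qed.

Fact perm_le g u : `|perm_fun g u| <= 1 * `|u|.
Proof. by rewrite mul1r; apply: ell2_norm_le => // N; exact: perm_sum_le. Qed.

Lemma perm_funM g h u : perm_fun (g * h)%g u = perm_fun g (perm_fun h u).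
Proof. by apply: ell2_ext => n; rewrite !perm_funE invgM actM. Qed.

Lemma perm_fun1 u : perm_fun 1%g u = u.
Proof. by apply: ell2_ext => n; rewrite perm_funE invg1 act1. Qed.

(** Both [g] and its inverse act by contractions. *)
Lemma perm_norm g u : `|perm_fun g u| = `|u|.
Proof.
apply/eqP; rewrite eq_le; apply/andP; split.
  by rewrite -[leRHS]mul1r; exact: perm_le.
rewrite -[in leLHS](perm_fun1 u) -(mulVg g) perm_funM -[leRHS]mul1r.
exact: perm_le.
Qed.

Lemma perm_dot g u v : ell2_dot (perm_fun g u) (perm_fun g v) = ell2_dot u v.
Proof.
have P (w : ell2 R) : ell2_dot (perm_fun g w) (perm_fun g w) = ell2_dot w w.
  by rewrite !ell2_dotE perm_norm.
(* Polarization. *)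
have Q (w : ell2 R) : ell2_dot (perm_fun g u) (perm_fun g w) +
    (ell2_dot (perm_fun g u) (perm_fun g w))^* = ell2_dot u w + (ell2_dot u w)^*.
  have := P (u + w).
  have -> : perm_fun g (u + w) = perm_fun g u + perm_fun g w by exact: ell2_ext.
  by rewrite !dnormD/= !P => /addrI.
have Qi := Q ('i *: v); have := Q v; move: Qi.
have -> : perm_fun g ('i *: v) = 'i *: perm_fun g v by exact: ell2_ext.
rewrite !linearZr_LR/= !rmorphM/= !conjCK conjCi.
set a := ell2_dot _ _; set b := ell2_dot u v => E1 E2.
have i0 : 'i != 0 :> R[i] by exact: neq0Ci.
have {}E1 : a - a^* = b - b^*.
  apply: (mulfI i0); apply: oppr_inj.
  by move: E1; rewrite !mulrBr !opprB !mulNr ![- _ + _]addrC.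
have {}E1 : a + a = b + b.
  have -> : a + a = (a - a^*) + (a + a^*) by rewrite addrACA addNr addr0.
  by rewrite E1 E2 addrACA addNr addr0.
by move/eqP: E1; rewrite -!mulr2n eqrMn2r// => /eqP.
Qed.

Definition perm_bop g : bop H := bounded_bop (perm_linear g) ltr01 (perm_le g).

Definition perm_rep : unitary_rep R G.
Proof.
apply: (@UnitaryRep R G H perm_bop) => [|g h|g x y].
- by apply: bop_ext => u; exact: perm_fun1.
- by apply: bop_ext => u; exact: perm_funM.
- exact: perm_dot.
Defined.

Lemma diag_perm_commute (c : nat -> R) (M : R) (cM : forall n, `|c n| <= M) g :
  (forall n, c (act g n) = c n) -> diag cM * perm_bop g = perm_bop g * diag cM.
Proof.
move=> cg; apply: bop_ext => u; apply: ell2_ext => n.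
rewrite -[LHS]/(ell2_val (diag cM (perm_bop g u)) n) (diagE cM).
rewrite -[RHS]/(ell2_val (diag cM u) (act g^-1%g n)) (diagE cM).
by rewrite -{1}[n](actVK g) cg.
Qed.

(** * Commutators with a diagonal operator that is constant on orbits up to a bounded
    perturbation *)

Section DiagonalCommutator.
Variables (d c : nat -> R) (M : R).
Hypothesis cM : forall n, `|c n| <= M.
Hypothesis d_ge1 : forall n, 1 <= d n.
Hypothesis d_act : forall g n, d (act g n) = d n.

Let dV_le1 n : `|(d n)^-1| <= 1.
Proof.
have d0 : 0 < d n by exact: lt_le_trans (d_ge1 n).
by rewrite ger0_norm ?invf_le1// invr_ge0 ltW.
Qed.

(** The domain of multiplication by [d] is the range of the bounded inverse [diag dV_le1]. Questions
    about the unbounded operator thus become questions about a bounded one, to which [gc_commute]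
    applies. *)
Lemma mul_dom_inv (u : ell2 R) :
  mul_dom d (diag dV_le1 u) /\ mulop d (diag dV_le1 u) = u.
Proof.
apply: mul_domP => n; rewrite (diagE dV_le1) mulrA -rmorphM/= mulfV ?mul1r//.
by rewrite gt_eqF// (lt_le_trans _ (d_ge1 n)).
Qed.

Lemma mul_dom_invE (u : ell2 R) : mul_dom d u -> u = diag dV_le1 (mulop d u).
Proof.
move=> du; apply: ell2_ext => n; rewrite (diagE dV_le1) mulopE// mulrA -rmorphM/=.
by rewrite mulVf ?mul1r// gt_eqF// (lt_le_trans _ (d_ge1 n)).
Qed.

Lemma mul_domD (u : ell2 R) : mul_dom d u ->
  mul_dom (fun n => d n + c n) u /\
  mulop (fun n => d n + c n) u = mulop d u + diag cM u.
Proof.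
move=> du; apply: mul_domP => n.
by rewrite ell2DE mulopE// (diagE cM) -mulrDl -rmorphD.
Qed.

Lemma mul_domD_sub (u : ell2 R) : mul_dom (fun n => d n + c n) u -> mul_dom d u.
Proof.
move=> dcu; apply: proj1 (@mul_domP R d u (mulop (fun n => d n + c n) u - diag cM u) _).
by move=> n; rewrite ell2BE mulopE// (diagE cM) -mulrBl -rmorphB/= addrK.
Qed.

(** The inverse of [d] commutes with [x perm_rep], which therefore preserves the domain and commutes
    with multiplication by [d]. Adding the bounded [c] leaves the domain unchanged, and only [c]
    contributes to the commutator. *)
Lemma diag_commutator (x : group_cstar R G) :
  is_commutator (diag_op (fun n => d n + c n)) (x perm_rep)
    (diag cM * x perm_rep - x perm_rep * diag cM).
Proof.
move=> v /= /mul_domD_sub dv.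
have xb : diag dV_le1 * x perm_rep = x perm_rep * diag dV_le1.
  by apply: (@gc_commute R G perm_rep (diag dV_le1) x) => g; apply: diag_perm_commute => n; rewrite d_act.
have xv : x perm_rep v = diag dV_le1 (x perm_rep (mulop d v)).
  rewrite [in LHS](mul_dom_invE dv).
  by have := congr1 (fun S : bop H => S (mulop d v)) xb.
have [dxv xvE] := mul_dom_inv (x perm_rep (mulop d v)).
have dxv' : mul_dom d (x perm_rep v) by rewrite xv.
have [dcv dcvE] := mul_domD dv; have [dcxv dcxvE] := mul_domD dxv'.
split => //; rewrite dcvE dcxvE linearD.
rewrite [in X in X + _ - _](_ : mulop d (x perm_rep v) = x perm_rep (mulop d v)).
  by rewrite addrAC opprD addrA subrr sub0r addrC.
by rewrite xv.
Qed.

End DiagonalCommutator.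
End PermutationRep.


(** * Faithfulness *)

Section GramSchmidt.
Variables (R : realType) (K : hilbert R).
Implicit Types (E : seq K) (v : K).

Definition orthonormal_seq E := uniq E /\
  forall e f, e \in E -> f \in E -> '[e, f] = (e == f)%:R :> R[i].

Definition oproj E v : K := \sum_(e <- E) '[v, e] *: e.

Lemma dot_oproj E v w : '[w, oproj E v] = \sum_(e <- E) ('[v, e])^* * '[w, e] :> R[i].
Proof.
by rewrite linear_sumr/=; apply: eq_bigr => e _; rewrite hdotZr.
Qed.

Lemma dot_self_oproj E v : '[v, oproj E v] = \sum_(e <- E) `|'[v, e]| ^+ 2 :> R[i].
Proof. by rewrite dot_oproj; apply: eq_bigr => e _; rewrite normCK mulrC. Qed.

Lemma oproj_dot E v f : orthonormal_seq E -> f \in E -> '[oproj E v, f] = '[v, f] :> R[i].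
Proof.
move=> [uE oE] fE; rewrite linear_sumlz/= (bigD1_seq f)//= hdotZl (oE f f)// eqxx mulr1.
rewrite big_seq_cond big1 ?addr0// => e /andP[eE ef].
by rewrite hdotZl (oE e f)// (negbTE ef) mulr0.
Qed.

Lemma bessel E v : orthonormal_seq E -> \sum_(e <- E) `|'[v, e]| ^+ 2 <= `|v| ^+ 2.
Proof.
move=> oE; have : 0 <= '[v - oproj E v, v - oproj E v] by rewrite hdotE exprn_ge0.
rewrite hdotBl !hdotBr dot_self_oproj hdotE.
have -> : '[oproj E v, v] = \sum_(e <- E) `|'[v, e]| ^+ 2 :> R[i].
  rewrite hdotC dot_self_oproj rmorph_sum/=; apply: eq_bigr => e _.
  by rewrite conj_Creal// ger0_real// exprn_ge0.
have -> : '[oproj E v, oproj E v] = \sum_(e <- E) `|'[v, e]| ^+ 2 :> R[i].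
  rewrite dot_oproj big_seq [RHS]big_seq; apply: eq_bigr => e eE.
  by rewrite oproj_dot// normCK mulrC.
by rewrite subrr subr0 subr_ge0.
Qed.

(** The family is extended by the normalised residual of each new vector, unless that residual
    vanishes. The conclusion says that [s] lies in the span of [E], which is what [parseval] asks
    for. *)
Lemma gram_schmidt (s : seq K) : exists2 E, orthonormal_seq E &
  forall v, v \in s -> oproj E v = v.
Proof.
elim: s => [|v s [E [uE oE] sE]]; first by exists [::].
pose w := v - oproj E v; have [w0|w0] := eqVneq w 0.
  exists E => // x; rewrite inE => /orP[/eqP->|/sE//].
  by apply/esym/eqP; rewrite -subr_eq0 -/w w0.
have nw : `|w| != 0 by rewrite normr_eq0.
pose e : K := `|w|^-1 *: w.
have we f : f \in E -> '[w, f] = 0 :> R[i].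
  by move=> fE; rewrite hdotBl oproj_dot// subrr.
have ef f : f \in E -> '[e, f] = 0 :> R[i] by move=> /we wf; rewrite hdotZl wf mulr0.
have fe f : f \in E -> '[f, e] = 0 :> R[i] by move=> /ef ef0; rewrite hdotC ef0 rmorph0.
have ee : '[e, e] = 1 :> R[i].
  rewrite hdotZl hdotZr hdotE conj_Creal ?ger0_real ?invr_ge0// mulrA expr2.
  by rewrite mulrACA mulVf// mulr1.
have eE : e \notin E.
  by apply/negP => /ef; rewrite ee => /eqP; rewrite oner_eq0.
have proje x : oproj (e :: E) x = '[x, e] *: e + oproj E x by rewrite /oproj big_cons.
have oprojE x : '[oproj E x, e] = 0 :> R[i].
  rewrite linear_sumlz/= big_seq big1// => f fE.
  by rewrite hdotZl fe// mulr0.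
exists (e :: E) => [|x].
  split => [|f g]; first by rewrite /= eE.
  rewrite !inE => /orP[/eqP->|fE] /orP[/eqP->|gE]; rewrite ?ee ?eqxx//.
  - by rewrite ef//; case: eqVneq => // eg; rewrite eg gE in eE.
  - by rewrite fe//; case: eqVneq => // fg; rewrite -fg fE in eE.
  - exact: oE.
rewrite inE proje => /orP[/eqP->|xs]; last by rewrite -[in '[x, e]](sE _ xs) oprojE scale0r add0r sE.
have -> : '[v, e] = `|w| :> R[i].
  have vE : v = w + oproj E v by rewrite subrK.
  rewrite {1}vE linearDl/= oprojE addr0 hdotZr hdotE.
  by rewrite conj_Creal ?ger0_real ?invr_ge0// expr2 mulrA mulVf// mul1r.
by rewrite scalerA mulfV// scale1r subrK.
Qed.

Lemma parseval E v : oproj E v = v -> `|v| ^+ 2 = \sum_(e <- E) `|'[v, e]| ^+ 2.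
Proof. by move=> vE; rewrite -dot_self_oproj vE hdotE. Qed.

End GramSchmidt.

(** * Foelner sets and the comparison of norms with an arbitrary representation *)

Section FaithfulPermutationRep.
Variables (R : realType) (G : groupType) (act : G -> nat -> nat).
Hypothesis act1 : forall n, act 1%g n = n.
Hypothesis actM : forall g h n, act (g * h)%g n = act g (act h n).
Local Notation H := (ell2_hilbert R).
Local Notation pi := (@perm_rep R G act act1 actM).

(* [F] is a Foelner set for [S], with [S]-interior [F0]. The ratio [4] is
   immaterial: injectivity of [pi] only needs [|rho(s)| <= C |pi(s)|]. *)
Definition foelner_separated := forall S : seq G, exists F F0 : seq G, exists n : nat,
  [/\ uniq F0 /\ (0 < size F0)%N, {subset F0 <= F}, (size F <= 4 * size F0)%N,
      forall h g, h \in F0 -> g \in S -> (g^-1 * h)%g \in F &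
      {in F &, injective (fun g => act g n)}].

Lemma urep_norm (rho : unitary_rep R G) g v : `|rho g v| = `|v|.
Proof. by apply/eqP; rewrite -(@eqrXn2 _ 2%N)// -!hdotE urep_dot. Qed.

Lemma perm_repE g (u : H) n : ell2_val (pi g u) n = ell2_val u (act g^-1%g n).
Proof. by []. Qed.

Lemma perm_rep_sumE s (u : H) n : ell2_val (rep_sum pi s u) n =
  \sum_(c <- s) c.1 * ell2_val u (act c.2^-1%g n).
Proof.
by rewrite /rep_sum bop_sumE ell2_sumE; apply: eq_bigr => c _; rewrite ell2ZE.
Qed.

Lemma delta_orthonormal (F : seq nat) : uniq F ->
  orthonormal_seq [seq (delta R n : H) | n <- F].
Proof.
move=> uF; split; first by rewrite map_inj_uniq//; exact: delta_inj.
have [dE _] := delta_basis R.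
by move=> _ _ /mapP[n _ ->] /mapP[m _ ->]; apply: dE; [exists n|exists m].
Qed.

Lemma foelner_bound (fs : foelner_separated) (rho : unitary_rep R G) s (M : R[i])
    (xi : urep_space rho) : 0 <= M ->
  (forall u : H, `|rep_sum pi s u| <= M * `|u|) ->
  `|rep_sum rho s xi| <= 2 * M * `|xi|.
Proof.
move=> M0 sM; have [F' [F0 [n [[uF0 F00] sF0' sz' FS' injF']]]] := fs [seq c.2 | c <- s].
(* Repeated elements would be counted several times in [c e]; removing them can only lower the
   size. *)
pose F := undup F'.
have uF : uniq F by exact: undup_uniq.
have FF' g : (g \in F) = (g \in F') by rewrite mem_undup.
have sF0 : {subset F0 <= F} by move=> g /sF0'; rewrite FF'.
have sz : (size F <= 4 * size F0)%N by exact: leq_trans (size_undup _) sz'.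
have FS h g : h \in F0 -> g \in [seq c.2 | c <- s] -> (g^-1 * h)%g \in F.
  by move=> hF gS; rewrite FF' FS'.
have injF : {in F &, injective (fun g => act g n)}.
  by move=> g h; rewrite !FF'; exact: injF'.
pose y := rep_sum rho s xi.
(* Only the translates of [y] have to be in the span of [E]: they need Parseval, while Bessel is
   enough for the translates of [xi]. *)
have [E oE EP] := gram_schmidt [seq rho h^-1%g y | h <- F0].
pose a e f : R[i] := '[rho f^-1%g xi, e].
pose c e : H := \sum_(f <- F) a e f *: (delta R (act f n) : H).
have cE e f : f \in F -> ell2_val (c e) (act f n) = a e f.
  move=> fF; rewrite ell2_sumE (bigD1_seq f)//; rewrite ell2ZE deltaE eqxx mulr1.
  rewrite big_seq_cond big1 => [|g /andP[gF gf]]; first exact: addr0.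
  rewrite ell2ZE deltaE; case: eqP; rewrite ?mulr0// => /injF fg.
  by rewrite fg ?eqxx in gf.
have c_norm e : `|c e| ^+ 2 = \sum_(f <- F) `|a e f| ^+ 2.
  rewrite -hdotE {1}/c linear_sumlz/= big_seq [RHS]big_seq; apply: eq_bigr => f fF.
  rewrite -[LHS]/('[a e f *: (delta R (act f n) : H), c e]) hdotZl hdotC.
  rewrite -[X in X^*]/(ell2_dot (c e) (delta R (act f n))).
  by rewrite dot_delta cE// -normCK.
(* For [h] in the interior every point [g^-1 * h] lies in [F], so no coefficient is lost to
   truncation and [s] acts on the coefficients as it does on [xi]. *)
have sc e h : h \in F0 -> ell2_val (rep_sum pi s (c e)) (act h n) = '[rho h^-1%g y, e].
  move=> hF; rewrite perm_rep_sumE.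
  rewrite /y /rep_sum bop_sumE linear_sum linear_sumlz/=.
  rewrite big_seq [RHS]big_seq; apply: eq_bigr => g gs.
  have gS : g.2 \in [seq c.2 | c <- s] by apply: map_f.
  rewrite -actM cE; last exact: FS.
  rewrite linearZ hdotZl /a invgM invgK; congr (_ * '[_, _]).
  by rewrite urepM.
have low e : \sum_(h <- F0) `|'[rho h^-1%g y, e]| ^+ 2 <= M ^+ 2 * `|c e| ^+ 2.
  rewrite -exprMn; apply: (@le_trans _ _ (`|rep_sum pi s (c e)| ^+ 2)); last first.
    by rewrite ler_pXn2r ?nnegrE ?mulr_ge0.
  have uA : uniq [seq act h n | h <- F0].
    by rewrite map_inj_in_uniq// => g h /sF0 gF /sF0 hF; exact: injF.
  have := bessel (rep_sum pi s (c e)) (delta_orthonormal uA).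
  rewrite !big_map; apply: le_trans; rewrite le_eqVlt; apply/orP; left; apply/eqP.
  rewrite big_seq [RHS]big_seq; apply: eq_bigr => h hF; rewrite -sc//.
  by rewrite -[RHS]/(`|ell2_dot (rep_sum pi s (c e)) (delta R (act h n))| ^+ 2) dot_delta.
(* Summing [low] over [E]: by unitarity each [h] in [F0] contributes the full squared norm of [y] on
   the left, and each [f] in [F] at most that of [xi] on the right. *)
have : `|y| ^+ 2 *+ size F0 <= M ^+ 2 * (`|xi| ^+ 2 *+ size F).
  apply: (@le_trans _ _ (\sum_(e <- E) \sum_(h <- F0) `|'[rho h^-1%g y, e]| ^+ 2)).
    rewrite exchange_big/= -iter_addr_0 -[X in iter X]count_predT -big_const_seq.
    rewrite big_seq [leRHS]big_seq; apply: ler_sum => h hF.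
    rewrite -(@urep_norm rho h^-1%g y) (parseval (EP _ _))//.
    by apply: map_f.
  apply: (@le_trans _ _ (\sum_(e <- E) M ^+ 2 * `|c e| ^+ 2)).
    by apply: ler_sum => e _; exact: low.
  rewrite -mulr_sumr ler_wpM2l ?exprn_ge0//.
  under eq_bigr do rewrite c_norm.
  rewrite exchange_big/= -iter_addr_0 -[X in iter X]count_predT -big_const_seq.
  apply: ler_sum => f _; rewrite -(@urep_norm rho f^-1%g xi).
  exact: bessel.
move=> yxi; rewrite -(@ler_pXn2r _ 2%N) ?nnegrE ?mulr_ge0//.
rewrite -(@ler_pMn2r _ (size F0))//; apply: le_trans yxi _.
(* The ratio [4] of the sizes becomes the factor [2] of the conclusion after taking square roots. *)
have szr : (size F)%:R <= 4 * (size F0)%:R :> R[i] by rewrite -natrM ler_nat.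
rewrite -mulr_natr -[leRHS]mulr_natr.
rewrite (_ : (2 * M * `|xi|) ^+ 2 * _ = M ^+ 2 * (`|xi| ^+ 2 * (4 * (size F0)%:R))); last by ring.
by rewrite ler_wpM2l ?exprn_ge0// ler_wpM2l// exprn_ge0.
Qed.

Lemma perm_rep_faithful : foelner_separated -> injective (eval_rep pi).
Proof.
move=> fs x y /= xy; apply: gc_ext => rho; apply: bop_ext => v.
apply/eqP; rewrite -subr_eq0; apply/eqP.
(* Here [6 = 1 + 4 + 1]: the outer terms approximate [x] and [y], and [foelner_bound] turns the
   bound [e + e] for the difference [u] under [pi] into [2 * (e + e)] under [rho]. *)
apply: (@small_norm_eq0 _ _ _ (6 * (`|v| + 1))); first by rewrite mulr_gt0// ltr_wpDl.
move=> e e0; have [s xs] := gc_approx x e0; have [t yt] := gc_approx y e0.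
pose u := s ++ [seq (- 1 * c.1, c.2) | c <- t].
have uE (r : unitary_rep R G) w : rep_sum r u w = rep_sum r s w - rep_sum r t w.
  by rewrite rep_sum_cat rep_sum_scale -[RHS]/((rep_sum r s - rep_sum r t) w) scaleN1r.
have upi (w : H) : `|rep_sum pi u w| <= (e + e) * `|w|.
  rewrite uE -(subrKA (x pi w)) mulrDl; apply: le_trans (ler_normD _ _) _.
  apply: lerD; first by rewrite distrC; exact: xs.
  by rewrite xy; exact: yt.
have ee0 : 0 <= e + e by rewrite addr_ge0// ltW.
have urho := foelner_bound fs v ee0 upi.
rewrite (_ : x rho v - y rho v = (x rho v - rep_sum rho s v) +
  (rep_sum rho u v + (rep_sum rho t v - y rho v))); last first.
  by rewrite uE !subrKA.
apply: (@le_trans _ _ (6 * e * `|v|)); last first.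
  by rewrite mulrCA mulrA ler_wpM2l ?mulr_ge0 ?(ltW e0)// lerDl.
apply: le_trans (ler_normD _ _) _.
apply: le_trans (lerD (xs _ _) (le_trans (ler_normD _ _) (lerD urho _))) _.
  by rewrite distrC; exact: yt.
by rewrite -!mulrDl ler_wpM2r// le_eqVlt; apply/orP; left; apply/eqP; ring.
Qed.

End FaithfulPermutationRep.


(** * Specialization of integral polynomials at prime fields *)

Section IntegerSpecialization.
Local Notation ieval g x := (map_poly intr g).[x].

Lemma ieval_int (K : nzRingType) (g : {poly int}) (n : int) :
  ieval g (n%:~R : K) = (g.[n])%:~R.
Proof. by rewrite horner_map. Qed.

Lemma intr_Fp_eq0 p (n : int) : prime p -> ((n%:~R : 'F_p) == 0) = (p %| n)%Z.
Proof. by move=> pp; rewrite (dvdz_pcharf (pchar_Fp pp)). Qed.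

Lemma poly_int_neq0_nat (P : {poly int}) : P != 0 -> exists n : nat, P.[n%:Z] != 0.
Proof.
move=> P0; apply: contrapT => /forallNP Pn.
have /(max_poly_roots P0) : all (root P) [seq i%:Z | i <- iota 0 (size P)].
  by apply/allP => _ /mapP[i _ ->]; apply/negPn/negP/Pn.
rewrite map_inj_uniq ?iota_uniq// => [/(_ isT)|i j []//].
by rewrite size_map size_iota ltnn.
Qed.

Variables (F : numFieldType) (a : F).
Hypothesis a0 : a != 0.

Definition annihilates (x : F) (f : {poly int}) := f != 0 /\ ieval f x = 0.

Lemma minimal_annihilator (x : F) f0 : annihilates x f0 -> exists f,
  annihilates x f /\ forall g, annihilates x g -> (size f <= size g)%N.
Proof.
move=> xf0; have ex : exists n, `[< exists2 f, annihilates x f & size f = n >].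
  by exists (size f0); apply/asboolP; exists f0.
case: (ex_minnP ex) => n /asboolP[f xf <-] nmin; exists f; split=> // g xg.
by apply: nmin; apply/asboolP; exists g.
Qed.

(** Otherwise ['X] could be divided out, leaving a shorter annihilator because [x] is nonzero. *)
Lemma minimal_annihilator_cst (x : F) f : x != 0 -> annihilates x f ->
  (forall g, annihilates x g -> (size f <= size g)%N) -> f.[0] != 0.
Proof.
move=> x0 [f0 fx] fmin; apply/negP => /factor_theorem[q]; rewrite subr0 => fE.
have q0 : q != 0 by apply: contraNneq f0 => q0; rewrite fE q0 mul0r.
have : annihilates x q.
  split => //; move: fx; rewrite fE rmorphM/= map_polyX hornerM hornerX.
  by move/eqP; rewrite mulf_eq0 (negbTE x0) orbF => /eqP.
by move/fmin; rewrite fE size_mulX// ltnn.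
Qed.

(** Pseudo-division: the power of the leading coefficient clears denominators, and the remainder is
    too short to be a nonzero annihilator. *)
Lemma minimal_annihilator_dvd (x : F) f g : annihilates x f ->
  (forall g, annihilates x g -> (size f <= size g)%N) -> ieval g x = 0 ->
  exists k q, lead_coef f ^+ k *: g = q * f.
Proof.
move=> [f0 fx] fmin gx; exists (scalp g f), (g %/ f).
rewrite Pdiv.Idomain.divp_eq; suff -> : g %% f = 0 by rewrite addr0.
apply: contrapT => /eqP r0; have : annihilates x (g %% f).
  split => //; have := congr1 (fun h => ieval h x) (Pdiv.Idomain.divp_eq g f).
  rewrite -mul_polyC !rmorphD !rmorphM/= !hornerE gx fx !mulr0 add0r.
  by move/esym.
by move/fmin; rewrite leqNgt Pdiv.Idomain.ltn_modp f0.
Qed.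

Lemma annihilator_algebraic (x : F) f : annihilates x f -> algebraicOver (ratr : rat -> F) x.
Proof.
move=> [f0 fx]; exists (map_poly intr f).
  by rewrite map_poly_eq0_id0// intr_eq0 lead_coef_eq0.
rewrite -map_poly_comp; apply/eqP; rewrite -[RHS]fx; congr (_.[_]).
by apply: eq_map_poly => n /=; rewrite rmorph_int.
Qed.

Lemma algebraic_annihilator (x : F) : algebraicOver (ratr : rat -> F) x ->
  exists f, annihilates x f.
Proof.
move=> [p p0 /eqP px]; have [q [c c0 pE]] := rat_poly_scale p.
exists q; split.
  by apply: contraNneq p0 => q0; rewrite pE q0 map_poly0 scaler0.
move: px; rewrite pE linearZ/= hornerZ => /eqP; rewrite mulf_eq0 fmorph_eq0.
rewrite invr_eq0 intr_eq0 (negbTE c0)/= -map_poly_comp => /eqP px.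
rewrite -[RHS]px; congr (_.[_]).
by apply: eq_map_poly => n /=; rewrite rmorph_int.
Qed.

Lemma annihilator_ieval (P : {poly int}) f : annihilates a f ->
  exists h, annihilates (ieval P a) h.
Proof.
move=> /annihilator_algebraic/integral_algebraic ai.
apply/algebraic_annihilator/integral_algebraic.
apply: integral_horner => //; apply/integral_poly => i.
rewrite coef_map/= -[_%:~R](rmorph_int (ratr : {rmorphism rat -> F})).
exact: integral_id.
Qed.

(* Values of [f] at multiples of [f.[0] * M] are [f.[0]] times an integer that
   is [1] modulo [M]. *)
Lemma prime_divisor_of_value (f : {poly int}) (M : int) :
  (1 < size f)%N -> f.[0] != 0 -> M != 0 ->
  exists p : nat, exists x : int, [/\ prime p, ~~ (p %| M)%Z & (p %| f.[x])%Z].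
Proof.
move=> sf c0 M0; set c := f.[0] in c0 *.
have /factor_theorem[f1] : root (f - c%:P) 0 by rewrite /root !hornerE subrr.
rewrite subr0 => f1E; have fE x : f.[x] = c + x * f1.[x].
  have := congr1 (fun h => h.[x]) f1E; rewrite !hornerE => /eqP.
  by rewrite subr_eq => /eqP->; rewrite addrC mulrC.
pose g := f \Po ((c * M)%:P * 'X).
have cM0 : c * M != 0 by rewrite mulf_neq0.
have sg : size g = size f.
  have := size_comp_poly f ((c * M)%:P * 'X).
  rewrite mul_polyC size_scale// size_polyX muln1 => sE.
  have g0 : g != 0.
    apply/eqP => g0; move: sE; rewrite -mul_polyC -/g g0 size_poly0/=.
    by case: (size f) sf => [|[|n]].
  rewrite -mul_polyC -/g in sE.
  by rewrite -(prednK (_ : 0 < size f)%N) ?(ltnW sf)// -sE prednK// size_poly_gt0.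
have gC (e : int) : g - e%:P != 0.
  rewrite subr_eq0; apply/eqP => gE; have := size_polyC_leq1 e.
  by rewrite -gE sg leqNgt sf.
have g0 : g != 0 by have := gC 0; rewrite polyC0 subr0.
(* The value of [g] at [t] is [c * v]; the three factors exclude [0], [1] and [-1] as values of [v],
   which then has a prime divisor. *)
have /poly_int_neq0_nat[t] : g * ((g - c%:P) * (g - (- c)%:P)) != 0.
  by rewrite !mulf_neq0.
pose x := c * M * t%:Z; pose v := 1 + M * t%:Z * f1.[x].
have gt : g.[t%:Z] = c * v.
  by rewrite /g horner_comp !hornerE -/x fE /v /x; ring.
rewrite hornerM hornerM !hornerD !hornerN !hornerC gt !mulf_eq0 !negb_or.
rewrite !(subr_eq0 (c * v)).
rewrite -[X in c * v != X]mulr1 -[X in c * v != - X]mulr1 -mulrN.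
rewrite !(inj_eq (mulfI c0)) => /andP[/andP[_ v0] /andP[v1 vN1]].
have [|p pp pv] := @pdivP `|v|%N; first by move: v0 v1 vN1; lia.
exists p, x; split => //; last by rewrite fE (_ : c + _ = c * v) ?dvdz_mull// /v /x; ring.
apply/negP => pM; have : (p %| (1 : int)%R)%Z.
  have -> : 1 = v - M * t%:Z * f1.[x] by rewrite /v; ring.
  by rewrite rpredB// -mulrA dvdz_mulr.
by rewrite dvdz1 => /eqP p1; rewrite -[p]/`|p|%N p1 in pp.
Qed.

(** Says that [a |-> r] induces a ring morphism from [Z[a, 1/a]] to ['F_p] that does not kill the
    given element. If [a] has no annihilator there are no relations to respect, and an integer
    modulo a large prime will do; otherwise [r] is a root modulo [p] of a minimal annihilator. *)
Lemma specialization (P : {poly int}) : ieval P a != 0 -> exists p : nat,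
  exists r : 'F_p, [/\ prime p, r != 0, ieval P r != 0 &
    forall g : {poly int}, ieval g a = 0 -> ieval g r = 0].
Proof.
move=> Pa; have P0 : P != 0 by apply: contraNneq Pa => ->; rewrite rmorph0 horner0.
have [[f0 af0]|noann] := pselect (exists f, annihilates a f); last first.
  have [n] : exists n : nat, (P * 'X).[n%:Z] != 0.
    by apply: poly_int_neq0_nat; rewrite mulf_neq0// polyX_eq0.
  rewrite hornerM hornerX => Pn.
  have [p pgt pp] := prime_above (absz (P.[n%:Z] * n%:Z)).
  have : ((P.[n%:Z] * n%:Z)%:~R : 'F_p) != 0.
    rewrite intr_Fp_eq0// dvdzE; apply/negP => /dvdn_leq; rewrite absz_gt0 => /(_ Pn).
    by rewrite leqNgt pgt.
  rewrite intrM mulf_eq0 negb_or => /andP[Pp np].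
  exists p, n%:~R; split=> // [|g ga]; first by rewrite ieval_int.
  suff -> : g = 0 by rewrite rmorph0 horner0.
  by apply: contrapT => /eqP g0; apply: noann; exists g.
have [f [af fmin]] := minimal_annihilator af0.
have [h0 ah0] := annihilator_ieval P af0.
have [h [ah hmin]] := minimal_annihilator ah0.
have fc := minimal_annihilator_cst a0 af fmin.
have hc := minimal_annihilator_cst Pa ah hmin.
have [f0' fa] := af.
have sf : (1 < size f)%N.
  rewrite ltnNge; apply/negP => /size1_polyC fE.
  by move: fa f0'; rewrite fE map_polyC hornerC/= => /eqP; rewrite intr_eq0 => /eqP->; rewrite eqxx.
(* The prime must miss three integers: [lead_coef f], so that pseudo-division by [f] can be undone
   modulo [p]; [h.[0]], because [h \Po P] kills [a], hence also [r], and would take the value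
   [h.[0]] if [P] vanished at [r]; and [f.[0]], so that [r] is nonzero. *)
have M0 : lead_coef f * h.[0] * f.[0] != 0.
  by rewrite !mulf_neq0// lead_coef_eq0.
have [p [x [pp pM pf]]] := prime_divisor_of_value sf fc M0.
have := pM; rewrite -(intr_Fp_eq0 _ pp) !intrM !mulf_eq0 !negb_or => /andP[/andP[lp hp] fp].
have fr : ieval f (x%:~R : 'F_p) = 0 by apply/eqP; rewrite ieval_int intr_Fp_eq0.
have ker (g : {poly int}) : ieval g a = 0 -> ieval g (x%:~R : 'F_p) = 0.
  move=> ga; have [k [q gE]] := minimal_annihilator_dvd af fmin ga.
  have := congr1 (fun h => ieval h (x%:~R : 'F_p)) gE.
  rewrite -mul_polyC !rmorphM/= !hornerE fr mulr0 map_polyC hornerC/= => /eqP.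
  by rewrite mulf_eq0 rmorphXn/= expf_eq0 (negbTE lp) andbF => /eqP.
exists p, x%:~R; split=> //.
  apply/eqP => x0; move: fr fp; rewrite x0 -[0 in X in X -> _](mulr0z 1).
  by rewrite ieval_int => ->; rewrite eqxx.
apply/eqP => Px; have : ieval (h \Po P) (x%:~R : 'F_p) = 0.
  by apply: ker; rewrite map_comp_poly horner_comp; case: ah.
rewrite map_comp_poly horner_comp Px -[0 in X in X -> _](mulr0z 1) ieval_int.
by move/eqP; rewrite (negbTE hp).
Qed.

End IntegerSpecialization.


(** * Finite actions *)

Section FiniteActions.
Variable G : groupType.

Record fin_action := FinAction {
  fa_set :> finType;
  fa_act : G -> fa_set -> fa_set;
  fa_act1 : forall x, fa_act 1%g x = x;
  fa_actM : forall g h x, fa_act (g * h)%g x = fa_act g (fa_act h x) }.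

(** * Countable disjoint unions of finite actions, realised on the natural numbers *)

Section Glue.
Variables (I : countType) (X : I -> fin_action).
Local Notation J := {i : I & fa_set (X i)}.

Definition glue_point i (x : X i) : nat := pickle (Tagged (fun i => fa_set (X i)) x : J).

(** Numbers that code no point are fixed, so that the action is defined on all of [nat]. *)
Definition glue_act (g : G) (n : nat) : nat :=
  if @pickle_inv J n is Some j then glue_point (fa_act g (tagged j)) else n.

Lemma glue_act_point g i (x : X i) : glue_act g (glue_point x) = glue_point (fa_act g x).
Proof. by rewrite /glue_act /glue_point pickleK_inv. Qed.

Lemma glue_point_inj i : injective (@glue_point i).
Proof. by move=> x y /(pcan_inj pickleK) /eqP; rewrite eq_Tagged => /eqP. Qed.

Lemma glue_cases n : (forall g, glue_act g n = n) \/ exists i (x : X i), n = glue_point x.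
Proof.
rewrite /glue_act; case E: (pickle_inv n) => [[i x]|]; [right|by left].
exists i, x; have := @pickle_invK J n; rewrite /= E /= => <-.
by rewrite /glue_point.
Qed.

Lemma glue_act1 n : glue_act 1%g n = n.
Proof.
by have [//|[i [x ->]]] := glue_cases n; rewrite glue_act_point fa_act1.
Qed.

Lemma glue_actM g h n : glue_act (g * h)%g n = glue_act g (glue_act h n).
Proof.
have [nE|[i [x ->]]] := glue_cases n; first by rewrite !nE.
by rewrite !glue_act_point fa_actM.
Qed.

Lemma glue_bounded n : exists m, forall g, (glue_act g n <= m)%N.
Proof.
have [nE|[i [x ->]]] := glue_cases n; first by exists n => g; rewrite nE.
exists (\max_(y : X i) glue_point y) => g; rewrite glue_act_point.
exact: (@leq_bigmax (fa_set (X i)) (fun y => glue_point y) (fa_act g x)).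
Qed.

End Glue.

Section OrbitTop.
Variable act : G -> nat -> nat.
Hypothesis act1 : forall n, act 1%g n = n.
Hypothesis actM : forall g h n, act (g * h)%g n = act g (act h n).
Hypothesis act_bounded : forall n, exists m, forall g, (act g n <= m)%N.

(** Takes the maximum of the orbit. This gives weights that are constant on orbits and still grow at
    least as fast as [n]. *)
Lemma orbit_top : exists top : nat -> nat,
  (forall n, n <= top n)%N /\ forall g n, top (act g n) = top n.
Proof.
have ex n : exists m, `[< forall g, act g n <= m >]%N.
  by have [m nm] := act_bounded n; exists m; apply/asboolP.
exists (fun n => ex_minn (ex n)); split=> [n|g n].
  by case: ex_minnP => m /asboolP /(_ 1%g); rewrite act1.
case: ex_minnP => m /asboolP gm mmin; case: ex_minnP => k /asboolP nk kmin.
apply/eqP; rewrite eqn_leq mmin ?kmin//; apply/asboolP => h.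
  by have := gm (h * g^-1)%g; rewrite -actM -mulgA mulVg mulg1.
by rewrite -actM.
Qed.
End OrbitTop.

End FiniteActions.

(** * Laurent polynomials with integer coefficients *)

Section LaurentEvaluation.
Local Notation ieval g x := (map_poly intr g).[x].

(** The sums that define [Ba], over any field: one list of coefficients and exponents can be read
    both in [R] and in a prime field. *)
Definition leval (K : fieldType) (s : seq (int * int)) (x : K) : K :=
  \sum_(p <- s) p.1%:~R * x ^ p.2.

Lemma leval_cat (K : fieldType) s t (x : K) : leval (s ++ t) x = leval s x + leval t x.
Proof. by rewrite /leval big_cat. Qed.

Definition lneg (s : seq (int * int)) := [seq (- p.1, p.2) | p <- s].

Lemma leval_neg (K : fieldType) s (x : K) : leval (lneg s) x = - leval s x.
Proof.
rewrite /leval big_map -sumrN; apply: eq_bigr => p _.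
by rewrite mulrNz mulNr.
Qed.

Definition lshift (l : int) (s : seq (int * int)) := [seq (p.1, l + p.2) | p <- s].

Lemma leval_shift (K : fieldType) l s (x : K) : x != 0 ->
  leval (lshift l s) x = x ^ l * leval s x.
Proof.
move=> x0; rewrite /leval big_map mulr_sumr; apply: eq_bigr => p _.
by rewrite expfzDr// mulrCA.
Qed.

(** Negative exponents are cleared by a power that depends on the list alone, so one integral
    polynomial serves all fields. *)
Lemma leval_poly s : exists (N : nat) (g : {poly int}), forall (K : fieldType) (x : K),
  x != 0 -> ieval g x = x ^+ N * leval s x.
Proof.
elim: s => [|[m n] s [N [g gE]]].
  by exists 0%N, 0 => K x _; rewrite rmorph0 horner0 /leval big_nil mulr0.
pose k := absz n; exists (N + k)%N, (g * 'X^k + m%:P * 'X^(N + absz (k%:Z + n))) => K x x0.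
rewrite rmorphD !rmorphM/= !map_polyXn map_polyC hornerD !hornerM !hornerXn hornerC.
rewrite gE// /leval big_cons/= -/(leval s x) mulrDr addrC !exprD; congr (_ + _); last first.
  by rewrite mulrAC.
rewrite [RHS]mulrCA; congr (_ * _); rewrite -mulrA; congr (_ * _).
by rewrite -[x ^+ absz _]/(x ^ (absz _)%:Z) gez0_abs ?expfzDr// /k; lia.
Qed.

End LaurentEvaluation.

Lemma intr_Zp_eq0 m (n : int) : (1 < m)%N -> ((n%:~R : 'Z_m) == 0) = (m %| n)%Z.
Proof.
move=> m1; have nat_eq0 k : ((k%:R : 'Z_m) == 0) = (m %| k)%N.
  by rewrite -val_eqE/= val_Zp_nat.
by case: n => k; rewrite ?NegzE ?rmorphN ?oppr_eq0 dvdzE ?abszN nat_eq0.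
Qed.

(** * Residual finiteness of [G_a] *)

Section GaResiduallyFinite.
Variables (R : realType) (a : {posnum R}).
Local Notation a_ := (a%:num : R).
Local Notation G := (Ga a).

Let a0 : a_ != 0. Proof. by rewrite gt_eqF. Qed.

Lemma leval_Ba s : leval s a_ \in Ba a.
Proof. by apply/BaP; exists s. Qed.

Definition Ba_of s : BaT a := MkBa (leval_Ba s).

Lemma Ba_of_surj b : exists s, b = Ba_of s.
Proof. by case: b => b bB; have /BaP[s bE] := bB; exists s; apply: val_inj. Qed.

Lemma Ba_residue (P : {poly int}) : (map_poly intr P).[a_] != 0 ->
  exists p (r : 'F_p) (phi : BaT a -> 'F_p), [/\ r != 0, (map_poly intr P).[r] != 0 &
    forall s, phi (Ba_of s) = leval s r].
Proof.
move=> /(specialization a0)[p [r [pp r0 Pr ker]]].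
have kerl s : leval s a_ = 0 -> leval s r = 0.
  move=> sa; have [N [g gE]] := leval_poly s.
  have : (map_poly intr g).[r] = 0 by apply: ker; rewrite gE// sa mulr0.
  by rewrite gE// => /eqP; rewrite mulf_eq0 expf_eq0 (negbTE r0) andbF => /eqP.
(* The morphism is defined on a chosen list for each element; by [kerl] any other list has the same
   value at [r]. *)
have [code codeE] := choice Ba_of_surj.
exists p, r, (fun b => leval (code b) r); split=> // s.
apply/eqP; rewrite -subr_eq0 -leval_neg -leval_cat; apply/eqP/kerl.
rewrite leval_cat leval_neg; apply/eqP; rewrite subr_eq0; apply/eqP.
by have := codeE (Ba_of s) => /(congr1 val) /= ->.
Qed.

Section ResidueAction.
Variables (p : nat) (r : 'F_p) (phi : BaT a -> 'F_p) (m : nat).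
Hypothesis r0 : r != 0.
Hypothesis phiE : forall s, phi (Ba_of s) = leval s r.

Lemma phiD b c : phi (b + c) = phi b + phi c.
Proof.
have [s ->] := Ba_of_surj b; have [t ->] := Ba_of_surj c.
have -> : Ba_of s + Ba_of t = Ba_of (s ++ t) by apply: val_inj; rewrite /= leval_cat.
by rewrite !phiE leval_cat.
Qed.

Lemma phi_act l b : phi (Ba_act l b) = r ^ l * phi b.
Proof.
have [s ->] := Ba_of_surj b.
have -> : Ba_act l (Ba_of s) = Ba_of (lshift l s) by apply: val_inj; rewrite /= leval_shift.
by rewrite !phiE leval_shift.
Qed.

(** The affine action of [G_a] over ['F_p], paired with the translation action of the shift on
    ['Z_m]. The orbit map of the origin reads off [phi] of the translation part and the shift modulo
    [m]. *)
Definition residue_act (g : G) (x : 'F_p * 'Z_m) : 'F_p * 'Z_m :=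
  (phi (Ga_trans g) + r ^ Ga_shift g * x.1, (Ga_shift g)%:~R + x.2).

Fact residue_act1 x : residue_act 1%g x = x.
Proof.
have phi0 : phi 0 = 0 by apply: (addrI (phi 0)); rewrite -phiD !addr0.
by case: x => x k; rewrite /residue_act /= phi0 expr0z mul1r !add0r.
Qed.

Fact residue_actM g h x : residue_act (g * h)%g x = residue_act g (residue_act h x).
Proof.
rewrite /residue_act /= phiD phi_act; congr pair.
  by rewrite mulrDr addrA mulrA -expfzDr.
by rewrite intrD addrA.
Qed.

Definition residue_action : fin_action G := FinAction residue_act1 residue_actM.

End ResidueAction.

Lemma Ga_residually_finite (F : seq G) : exists (X : fin_action G) (x : X),
  {in F &, injective (fun g => fa_act g x)}.
Proof.
have [code codeE] := choice Ba_of_surj.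
have /choice[N' /choice[pol polE]] := leval_poly.
pose df g h := pol (code (Ga_trans g) ++ lneg (code (Ga_trans h))).
have dfE (K : fieldType) (y : K) g h : y != 0 -> (map_poly intr (df g h)).[y] =
    y ^+ (N' (code (Ga_trans g) ++ lneg (code (Ga_trans h)))) *
    (leval (code (Ga_trans g)) y - leval (code (Ga_trans h)) y).
  by move=> y0; rewrite polE// leval_cat leval_neg.
(* One nonvanishing condition on the product of all differences keeps every pair of distinct
   translation parts apart in ['F_p]. *)
pose P := \prod_(g <- F) \prod_(h <- F | Ga_trans g != Ga_trans h) df g h.
have [|p [r [phi [r0 Pr phiE]]]] := @Ba_residue P.
  rewrite rmorph_prod horner_prod prodf_seq_neq0; apply/allP => g _.
  rewrite rmorph_prod horner_prod prodf_seq_neq0; apply/allP => h _; apply/implyP => gh.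
  rewrite dfE// mulf_neq0// ?expf_neq0// subr_eq0; apply: contraNneq gh => gh.
  rewrite (codeE (Ga_trans g)) (codeE (Ga_trans h)); apply/eqP; exact: val_inj.
pose M := \max_(g <- F) `|Ga_shift g|%N.
have sM g : g \in F -> (`|Ga_shift g| <= M)%N by move=> gF; exact: leq_bigmax_seq.
(* Shifts from [F] differ by at most [2 * M], so they are equal once congruent modulo [2 * M + 2];
   this modulus also exceeds [1], as [intr_Zp_eq0] requires. *)
exists (residue_action (2 * M).+2 r0 phiE), (0, 0) => g h gF hF /=.
rewrite /residue_act/= !mulr0 !addr0 => -[phigh shgh].
have gh_sh : Ga_shift g = Ga_shift h.
  have : (((2 * M).+2)%:Z %| Ga_shift g - Ga_shift h)%Z.
    by rewrite -intr_Zp_eq0// rmorphB/= shgh subrr.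
  rewrite dvdzE => /dvdn_leq; have := sM g gF; have := sM h hF.
  by case: (eqVneq (Ga_shift g) (Ga_shift h)) => // gh; lia.
have gh_tr : Ga_trans g = Ga_trans h.
  apply: contrapT => /eqP gh; move: Pr.
  rewrite rmorph_prod horner_prod prodf_seq_neq0 => /allP/(_ g gF)/=.
  rewrite rmorph_prod horner_prod prodf_seq_neq0 => /allP/(_ h hF)/implyP/(_ gh).
  rewrite dfE// -!phiE -!codeE phigh subrr mulr0 eqxx//.
by case: g h gh_sh gh_tr {gF hF phigh shgh} => [b l] [b' l'] /= -> ->.
Qed.

(** Supplies the set that [v] preserves and [u] does not: the shift modulo [2] acts on two
    points. *)
Lemma Ga_parity_action : exists (X : fin_action G) (f : X -> bool) (x : X),
  (forall y, f (fa_act (Ga_v a) y) = f y) /\ f (fa_act (Ga_u a) x) != f x.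
Proof.
pose act (g : G) (x : 'F_2) : 'F_2 := (Ga_shift g)%:~R + x.
have act1 x : act 1%g x = x by rewrite /act add0r.
have actM g h x : act (g * h)%g x = act g (act h x) by rewrite /act/= intrD addrA.
exists (FinAction act1 actM), (fun x => x == 0), 0; split=> [y|]; last by [].
by rewrite /= /act add0r.
Qed.

End GaResiduallyFinite.


(** * Foelner sets *)

Section AbelianFoelner.
Variable B : zmodType.

Lemma exp_beats_poly m : exists K, ((K.+1) ^ m < 2 ^ K)%N.
Proof.
(* With [K.+1 = 2 ^ j] the claim becomes [j * m + 1 < 2 ^ j]; the factor [3] makes [2 ^ j] a cube,
   at least [m.+2 ^ 3]. *)
pose j := (3 * m.+1)%N; exists (2 ^ j).-1; rewrite prednK ?expn_gt0// -expnM.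
rewrite ltn_exp2l// -ltnS prednK ?expn_gt0//.
have h k : (k < 2 ^ k)%N by exact: ltn_expl.
have -> : (2 ^ j = (2 ^ m.+1) ^ 3)%N by rewrite -expnM mulnC.
rewrite /j.
apply: (@leq_trans (m.+2 ^ 3)); last by rewrite leq_exp2r//; exact: h.
by rewrite !expnS expn0; nia.
Qed.

Variable W : seq B.

Fixpoint growth K : seq B :=
  if K is K'.+1 then undup (growth K' ++ [seq e - w | e <- growth K', w <- W])
  else [:: 0].

Lemma growth_uniq K : uniq (growth K).
Proof. by case: K => //= K; exact: undup_uniq. Qed.

Lemma growthS_sub K : {subset growth K <= growth K.+1}.
Proof. by move=> b bK; rewrite /= mem_undup mem_cat bK. Qed.

Lemma growth_gt0 K : (0 < size (growth K))%N.
Proof.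
have : 0 \in growth K by elim: K => [|K /growthS_sub//]; rewrite inE.
by case: (growth K).
Qed.

Lemma growthS_sub_w K e w : e \in growth K -> w \in W -> e - w \in growth K.+1.
Proof.
move=> eK wW; rewrite /= mem_undup mem_cat; apply/orP; right.
by apply/allpairsP; exists (e, w).
Qed.

(** By commutativity an element is determined by how often each entry of [W] has been subtracted, at
    most [K] times each. This yields the polynomial growth in [growth_size]. *)
Lemma growth_form K e : e \in growth K ->
  exists k : {ffun 'I_(size W) -> 'I_K.+1}, e = \sum_(i < size W) - (W`_i *+ k i).
Proof.
elim: K e => [|K IH] e /=.
  rewrite inE => /eqP->; exists [ffun=> ord0]; rewrite big1// => i _.
  by rewrite ffunE mulr0n oppr0.
have widen (k : {ffun 'I_(size W) -> 'I_K.+1}) (j : nat -> nat) :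
    (forall i : nat, j i <= 1)%N -> exists k' : {ffun 'I_(size W) -> 'I_K.+2},
    forall i : 'I_(size W), k' i = (k i + j i)%N :> nat.
  move=> j1; exists [ffun i : 'I_(size W) => inord (k i + j i)] => i; rewrite ffunE inordK//.
  by have := ltn_ord (k i); have := j1 i; lia.
rewrite mem_undup mem_cat => /orP[/IH[k ->]|/allpairsP[[f w]/= [/IH[k ->] wW ->]]].
  have [//|k' k'E] := widen k (fun=> 0%N).
  by exists k'; apply: eq_bigr => i _; rewrite k'E addn0.
have wi : (index w W < size W)%N by rewrite index_mem.
have [i|k' k'E] := widen k (fun i => (i == index w W)); first by case: eqP.
exists k'; rewrite (bigD1 (Ordinal wi))//= [RHS](bigD1 (Ordinal wi))//= k'E eqxx.
rewrite nth_index// mulrnDr mulr1n opprD -!addrA; congr (_ + _).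
rewrite addrC; congr (_ + _); apply: eq_bigr => i iw; rewrite k'E.
by have /negbTE -> : i != index w W :> nat by []; rewrite addn0.
Qed.

Lemma growth_size K : (size (growth K) <= K.+1 ^ size W)%N.
Proof.
rewrite -[X in (X ^ _)%N]card_ord -[X in (_ ^ X)%N]card_ord -card_ffun cardE.
rewrite -(size_map (fun k : {ffun 'I_(size W) -> 'I_K.+1} => \sum_(i < size W) - (W`_i *+ k i))).
apply: uniq_leq_size (growth_uniq K) _ => e /growth_form[k ->].
by apply: map_f; rewrite mem_enum.
Qed.

(** If the size more than doubled at every step it would grow at least like [2 ^ K], against the
    polynomial bound. *)
Lemma growth_doubling : exists K, (size (growth K.+1) <= 2 * size (growth K))%N.
Proof.
apply: contrapT => /forallNP nd; have [K KP] := exp_beats_poly (size W).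
suff /(_ K) : forall K, (2 ^ K <= size (growth K))%N.
  by move=> /leq_trans/(_ (growth_size K)); rewrite leqNgt KP.
elim=> [//|k IH]; have /negP := nd k; rewrite -ltnNge expnS => /ltnW.
by apply: leq_trans; rewrite leq_mul2l.
Qed.

End AbelianFoelner.

(** * Foelner sets of [G_a] and the action of [G_a] on the natural numbers *)

Section GaAction.
Variables (R : realType) (a : {posnum R}).
Local Notation G := (Ga a).

(* [(a^l e, l)] with [0 <= l < L] and [e \in E] is moved by [g^-1], for
   [g = (b, m)], to [(a^(l - m) (e - a^-l b), l - m)]. *)
Lemma Ga_foelner (S : seq G) : exists F F0 : seq G,
  [/\ uniq F0 /\ (0 < size F0)%N, {subset F0 <= F}, (size F <= 4 * size F0)%N &
      forall h g, h \in F0 -> g \in S -> (g^-1 * h)%g \in F].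
Proof.
pose M := \max_(g <- S) `|Ga_shift g|%N.
have SM g : g \in S -> (`|Ga_shift g| <= M)%N by move=> gS; exact: leq_bigmax_seq.
(* The interior levels, from [M] to [L - M - 1], stay below [L] and nonnegative after a shift by at
   most [M]. They number [2 * M + 2], more than half of [L]; with the doubling bound for [growth]
   this gives the ratio [4]. *)
pose L := (4 * M + 2)%N.
pose W := [seq Ba_act (- (l%:Z)) (Ga_trans g) | l <- iota 0 L, g <- S].
have [K KP] := growth_doubling W.
pose pt (l : nat) (e : BaT a) : G := MkGa (Ba_act l e) l.
exists [seq pt l e | l <- iota 0 L, e <- growth W K.+1].
exists [seq pt l e | l <- iota M (L - 2 * M), e <- growth W K].
split.
- split; last first.
    by rewrite size_allpairs size_iota muln_gt0 growth_gt0 andbT; lia.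
  apply: allpairs_uniq; [exact: iota_uniq|exact: growth_uniq|].
  move=> [l e] [l' e'] _ _ /= E; have := congr1 (@Ga_trans R a) E.
  have [<-] := congr1 (@Ga_shift R a) E; move=> /(congr1 (Ba_act (- (l%:Z)))) /=.
  by rewrite !Ba_actA addNr !Ba_act0 => ->.
- move=> _ /allpairsP[[l e]/= [lM eK ->]]; apply: allpairs_f; last exact: growthS_sub.
  by move: lM; rewrite !mem_iota; lia.
- rewrite !size_allpairs !size_iota.
  apply: (@leq_trans (L * (2 * size (growth W K)))); first by rewrite leq_mul2l KP orbT.
  have -> : (L - 2 * M = 2 * M + 2)%N by rewrite /L; lia.
  by rewrite /L; move: (size _) => n; nia.
- move=> _ g /allpairsP[[l e]/= [lM eK ->]] gS; have := SM g gS.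
  move: lM; rewrite mem_iota => lM gM.
  have lL : (l < L)%N by lia.
  have wW : Ba_act (- (l%:Z)) (Ga_trans g) \in W.
    by apply/allpairsP; exists (l, g); rewrite mem_iota.
  apply/allpairsP; exists (absz (l%:Z - Ga_shift g), e - Ba_act (- (l%:Z)) (Ga_trans g)).
  have lg : (absz (l%:Z - Ga_shift g))%:Z = l%:Z - Ga_shift g by rewrite gez0_abs//; lia.
  split => /=.
  - by rewrite mem_iota; lia.
  - exact: growthS_sub_w.
  - rewrite /pt lg; congr MkGa; last by rewrite /= addrC.
    rewrite /= Ba_actA Ba_actD Ba_actN Ba_actA addrC.
    by congr (_ + - _); congr Ba_act; ring.
Qed.

(** Gluing needs a countable index type; finite subsets of [G] are indexed by lists of integer
    data. *)
Definition index_point (c : seq (int * int) * int) : G := MkGa (Ba_of a c.1) c.2.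

Lemma index_point_surj g : exists c, index_point c = g.
Proof. by case: g => b l; have [s ->] := Ba_of_surj b; exists (s, l). Qed.

Lemma Ga_action : exists act : G -> nat -> nat,
  [/\ forall n, act 1%g n = n,
      forall g h n, act (g * h)%g n = act g (act h n),
      foelner_separated act,
      exists top : nat -> nat,
        (forall n, n <= top n)%N /\ forall g n, top (act g n) = top n &
      exists (c : nat -> bool) (n0 : nat),
        (forall n, c (act (Ga_v a) n) = c n) /\ c (act (Ga_u a) n0) != c n0].
Proof.
have [XP [f [xP [fv fu]]]] := Ga_parity_action a.
have Xex (F : seq (seq (int * int) * int)) : exists X : fin_action G, exists x : X,
    {in map index_point F &, injective (fun g => fa_act g x)}.
  exact: Ga_residually_finite.
have [XF XFP] := choice Xex.
(* The index [None] is reserved for the parity action, and every finite list of codes contributes an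
   action separating it. *)
pose X (i : option (seq (seq (int * int) * int))) := if i is Some F then XF F else XP.
pose act := glue_act X.
have act1 : forall n, act 1%g n = n by exact: glue_act1.
have actM : forall g h n, act (g * h)%g n = act g (act h n) by exact: glue_actM.
exists act; split=> //.
- move=> S; have [F [F0 [uF0 sF0 sz FS]]] := Ga_foelner S.
  have [code codeE] := choice index_point_surj.
  have [x xinj] := XFP (map code F).
  exists F, F0, (@glue_point G _ X (Some (map code F)) x); split => //.
  move=> g h gF hF; rewrite /act !glue_act_point => /glue_point_inj; apply: xinj.
    by rewrite -(codeE g); apply/map_f/map_f.
  by rewrite -(codeE h); apply/map_f/map_f.
- exact: (orbit_top act1 actM (@glue_bounded G _ X)).
- pose pP (x : XP) := @glue_point G _ X None x.
  (* The colouring is [f] on the parity component and [false] on all other points. *)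
  exists (fun n => `[< exists2 x : XP, n = pP x & f x >]), (pP xP).
  have cE x : `[< exists2 y : XP, pP x = pP y & f y >] = f x.
    apply/asboolP/idP => [[y /(@glue_point_inj G _ X None) ->//]|fx].
    by exists x.
  split=> [n|]; last by rewrite /act glue_act_point cE cE.
  have vP : forall m, (exists2 x : XP, m = pP x & f x) ->
      forall g, (forall y, f (fa_act g y) = f y) -> exists2 x : XP, act g m = pP x & f x.
    move=> _ [x -> fx] g fg; exists (fa_act g x); first by rewrite /act glue_act_point.
    by rewrite fg.
  apply/asboolP/asboolP => H; last exact: vP.
  (* Going back from the image of [n] to [n] uses the inverse of [v], which preserves [f] as
     well. *)
  have := vP _ H (Ga_v a)^-1%g; rewrite -actM mulVg act1; apply => y.
  by rewrite -[in LHS]fv -fa_actM mulgV fa_act1.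
Qed.

End GaAction.


(** * Spectral triples *)

Section DiagonalTriples.
Variables (R : realType) (G : groupType) (act : G -> nat -> nat).
Hypothesis act1 : forall n, act 1%g n = n.
Hypothesis actM : forall g h n, act (g * h)%g n = act g (act h n).
Hypothesis act_sep : foelner_separated act.
Variable top : nat -> nat.
Hypothesis top_ge : forall n, (n <= top n)%N.
Hypothesis top_act : forall g n, top (act g n) = top n.
Variable c : nat -> bool.

Local Notation H := (ell2_hilbert R).
Local Notation rho := (@perm_rep R G act act1 actM).
Local Notation cR := (fun n => (c n)%:R : R).

Fact indicator_le1 n : `|cR n| <= 1.
Proof. by rewrite ger0_norm ?ler0n// lern1; case: (c n). Qed.

(** The first term commutes with the representation and dominates [2 ^+ n]; the indicator is a
    bounded perturbation that carries the whole commutator. *)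
Definition orbit_weight n : R := 2 ^+ top n + cR n.

Lemma orbit_weight_ge n : 2 ^+ n <= orbit_weight n.
Proof. by apply: ler_wpDr; [exact: ler0n|apply: ler_weXn2l; rewrite ?ler1n]. Qed.

Lemma orbit_commutator (x : group_cstar R G) :
  is_commutator (diag_op orbit_weight) (eval_rep rho x)
    (diag indicator_le1 * x rho - x rho * diag indicator_le1).
Proof.
apply: (@diag_commutator R G act act1 actM (fun n => 2 ^+ top n)) => [n|g n].
  by apply: exprn_ege1; rewrite ler1n.
by rewrite top_act.
Qed.

Lemma orbit_spectral_triple : spectral_triple (eval_rep rho) (diag_op orbit_weight).
Proof.
split.
- exact: perm_rep_faithful.
- exact: diag_op_selfadjoint.
- by move=> x _; exists (diag indicator_le1 * x rho - x rho * diag indicator_le1);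
    exact: orbit_commutator.
- exists (resolvent orbit_weight); first exact: resolventP orbit_weight_ge.
  exact: resolvent_compact orbit_weight_ge.
Qed.

Lemma orbit_summable (p : R) : 1 <= p -> summable_op p (diag_op orbit_weight).
Proof. by apply: diag_op_summable; exact: orbit_weight_ge. Qed.

Lemma orbit_commutator_elt0 g : (forall n, c (act g n) = c n) ->
  is_commutator (diag_op orbit_weight) (eval_rep rho (gc_elt R g)) 0.
Proof.
move=> cg; have := orbit_commutator (gc_elt R g).
rewrite -[gc_elt R g rho]/(eval_rep rho (gc_elt R g)) eval_rep_elt.
rewrite -[rho g]/(perm_bop R act1 actM g) diag_perm_commute ?subrr// => n.
by rewrite cg.
Qed.

(** Applied to [delta n], the commutator has at [act g n] the coordinate [c (act g n) - c n]. *)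
Lemma orbit_commutator_neq0 g n : c (act g n) != c n ->
  diag indicator_le1 * rho g - rho g * diag indicator_le1 <> 0.
Proof.
move=> cg T0; pose u : H := delta R n.
have : ell2_val (diag indicator_le1 (rho g u)) (act g n) -
       ell2_val (rho g (diag indicator_le1 u)) (act g n) = 0.
  exact: (congr1 (fun T : bop H => ell2_val (T u) (act g n)) T0).
rewrite (diagE indicator_le1) !perm_repE (diagE indicator_le1) actK// deltaE eqxx !mulr1.
move/eqP; rewrite subr_eq0 => /eqP/(congr1 (@complex.Re R))/= /eqP.
by rewrite eqr_nat; move: cg; case: (c (act g n)); case: (c n).
Qed.

Lemma compact_op0 (K : hilbert R) : compact_op (0 : bop K).
Proof.
have : precompact [set (0 : K)].
  by apply: compact_precompact; [exact: norm_hausdorff|exact: compact_set1].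
by apply: precompact_subset => _ [v _ <-].
Qed.

End DiagonalTriples.

Theorem theorem5p3 (R : realType) (a : {posnum R}) (ha : a%:num != 1) :
  (exists (H : hilbert R) (pi : cstar_rep (Ga a) H) (D : unbounded_op H),
      spectral_triple pi D /\
      forall x : group_cstar R (Ga a), in_group_algebra x ->
        exists2 T : bop H, is_commutator D (pi x) T & compact_op T) /\
  (forall p : R, 1 <= p ->
    exists (H : hilbert R) (pi : cstar_rep (Ga a) H) (D : unbounded_op H),
      [/\ spectral_triple pi D,
          forall x : group_cstar R (Ga a), is_commutator D (pi x) 0 &
          summable_op p D]) /\
  (algebraicOver (ratr : rat -> R) a%:num ->
    forall p : R, 2 <= p ->
    exists (H : hilbert R) (pi : cstar_rep (Ga a) H) (D : unbounded_op H),
      [/\ spectral_triple pi D,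
          is_commutator D (pi (gc_elt R (Ga_v a))) 0,
          exists2 T : bop H,
            is_commutator D (pi (gc_elt R (Ga_u a))) T & T <> 0 &
          summable_op p D]).
Proof.
have [act [act1 actM sep [top [top_ge top_act]] [c0 [n0 [cv cu]]]]] := Ga_action a.
pose H := ell2_hilbert R; pose pi := eval_rep (@perm_rep R _ act act1 actM).
pose D c := diag_op (@orbit_weight R top c).
have triple c : spectral_triple pi (D c) by exact: orbit_spectral_triple.
(* With the empty indicator the perturbation vanishes and every commutator is [0], which settles
   (ii) and, [0] being compact, (i). *)
have comm0 x : is_commutator (D (fun=> false)) (pi x) 0.
  have := @orbit_commutator R _ act act1 actM top top_act (fun=> false) x.
  have -> : diag (@indicator_le1 R (fun=> false)) = 0.
    by apply: bop_ext => v; apply: ell2_ext => n; rewrite diagE mul0r.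
  by rewrite mul0r mulr0 subrr.
split; last split.
- exists H, pi, (D (fun=> false)); split; first exact: triple.
  move=> x _; exists 0; first exact: comm0.
  exact: compact_op0.
- move=> p p1; exists H, pi, (D (fun=> false)); split; [exact: triple|exact: comm0|].
  exact: orbit_summable.
- move=> _ p p2; exists H, pi, (D c0); split; first exact: triple.
  + exact: orbit_commutator_elt0.
  + exists (diag (@indicator_le1 R c0) * perm_bop R act1 actM (Ga_u a) -
            perm_bop R act1 actM (Ga_u a) * diag (@indicator_le1 R c0)).
      have := @orbit_commutator R _ act act1 actM top top_act c0 (gc_elt R (Ga_u a)).
      rewrite -[gc_elt R _ _]/(pi (gc_elt R (Ga_u a))) eval_rep_elt.
      by [].
    exact: orbit_commutator_neq0 cu.
  + by apply: orbit_summable => //; apply: le_trans p2; rewrite ler1n.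
Qed.
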